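(* Let $A$ be an extension base, let $p\in S(A)$ be generically stable, and let $q\in S(A)$ be co-dominated by $p$ over $A$. Then every Morley sequence in $q$ over $A$ is a strict Morley sequence over $A$.
   Context: $T$ is a complete first-order dependent (NIP) theory; we work in a monster model. $x\downarrow_A B$ means $\operatorname{tp}(x/AB)$ does not fork over $A$. $A$ is an extension base if no type over $A$ forks over $A$. A Morley sequence in $r\in S(A)$ over $A$ is an $A$-indiscernible sequence $\langle a_i\rangle$ of realizations of $r$ with $a_i\downarrow_A a_{<i}$ for all $i$. $p\in S(A)$ is generically stable if some (equivalently any) Morley sequence in $p$ over $A$ is an indiscernible set. $q$ is co-dominated by $p$ over $A$ if there are $a\models q$ and $b\models p$ such that for every $c$, $c\downarrow_A b$ implies $c\downarrow_A a$. Strict non-forking: $x\downarrow^{st}_A y$ means there is a global type $s\supseteq\operatorname{tp}(x/Ay)$ not forking over $A$ such that for every set $D\supseteq Ay$ and every $c\models s|_D$, $\operatorname{tp}(D/Ac)$ does not divide over $A$. A strict Morley sequence over $A$ is an $A$-indiscernible sequence with $a_i\downarrow^{st}_A a_{<i}$ for all $i$. *)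

(* Defs.v *)
From mathcomp Require Import all_boot all_order.
From mathcomp Require Import boolp classical_sets functions cardinality.

Set Implicit Arguments.
Unset Strict Implicit.
Unset Printing Implicit Defensive.

Local Open Scope classical_set_scope.

Record language := Language {
  fsym : Type;
  rsym : Type;
  farity : fsym -> nat;
  rarity : rsym -> nat }.

Section Syntax.
Variable L : language.

Inductive term (V : Type) : Type :=
| TVar of V
| TApp (f : fsym L) of ('I_(farity f) -> term V).

(* The free variables of [form V] range over [V]; the body of a quantifier has
   the additional free variable [None]. *)
Inductive form (V : Type) : Type :=
| FBot
| FEq of term V & term V
| FRel (r : rsym L) of ('I_(rarity r) -> term V)
| FImp of form V & form V
| FAll of form (option V).

Definition FNot V (phi : form V) : form V := FImp phi (FBot V).

Definition sentence := form void.

Record structure := Structure {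
  carrier :> Type;
  carrier_inhabited : inhabited carrier;
  fint : forall f : fsym L, ('I_(farity f) -> carrier) -> carrier;
  rint : forall r : rsym L, ('I_(rarity r) -> carrier) -> Prop }.

End Syntax.

Arguments fint {L} s f _.
Arguments rint {L} s r _.

Fixpoint eval L (M : structure L) V (v : V -> M) (t : term L V) : M :=
  match t with
  | TVar x => v x
  | TApp f ts => fint M f (fun i => eval v (ts i))
  end.

Definition scons (M V : Type) (m : M) (v : V -> M) (x : option V) : M :=
  if x is Some y then v y else m.

Fixpoint sat L (M : structure L) V (v : V -> M) (phi : form L V) : Prop :=
  match phi with
  | FBot => False
  | FEq s t => eval v s = eval v t
  | FRel r ts => rint M r (fun i => eval v (ts i))
  | FImp phi psi => sat v phi -> sat v psi
  | FAll phi => forall m : M, sat (scons m v) phi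
  end.

Definition holds L (M : structure L) (sigma : sentence L) : Prop :=
  sat (of_void M) sigma.

Definition model L (T : set (sentence L)) (M : structure L) : Prop :=
  forall sigma, T sigma -> holds M sigma.

Definition entails L (T : set (sentence L)) (sigma : sentence L) : Prop :=
  forall M : structure L, model T M -> holds M sigma.

Definition complete_theory L (T : set (sentence L)) : Prop :=
  (exists M : structure L, model T M) /\
  forall sigma, entails T sigma \/ entails T (FNot sigma).

Definition copair (X Y M : Type) (v : X -> M) (w : Y -> M) (z : X + Y) : M :=
  match z with inl x => v x | inr y => w y end.

Definition has_IP L (M : structure L) n m (phi : form L ('I_n + 'I_m)) : Prop :=
  exists (a : nat -> 'I_n -> M) (b : set nat -> 'I_m -> M),
    forall i S, sat (copair (a i) (b S)) phi <-> S i.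

Definition dependent L (T : set (sentence L)) : Prop :=
  forall M : structure L, model T M ->
    forall n m (phi : form L ('I_n + 'I_m)), ~ has_IP M phi.

Section Types.
Variables (L : language) (M : structure L).

(* A formula phi(x, b) with x = (x_i)_{i in X} and b a finite tuple in M. The
   tuple x may be infinite; a set D is turned into a tuple by enum_tuple. *)
Record pform (X : Type) := PForm {
  parity : nat;
  pmat : form L (X + 'I_parity);
  ppar : 'I_parity -> M }.

Arguments ppar {X} p _.

Definition psat X (v : X -> M) (th : pform X) : Prop :=
  sat (copair v (ppar th)) (pmat th).

Definition pover X (B : set M) (th : pform X) : Prop :=
  forall i, B (ppar th i).

Definition pnot X (th : pform X) : pform X :=
  PForm (FNot (pmat th)) (ppar th).

(* p is an element of S_X(B); the choice B = setT gives the global types. *)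
Definition complete_type X (B : set M) (p : set (pform X)) : Prop :=
  [/\ forall th, p th -> pover B th,
      forall n (th : 'I_n -> pform X), (forall i, p (th i)) ->
        exists v : X -> M, forall i, psat v (th i)
    & forall th, pover B th -> p th \/ p (pnot th)].

Definition realizes X (v : X -> M) (p : set (pform X)) : Prop :=
  forall th, p th -> psat v th.

Definition tp X (v : X -> M) (B : set M) : set (pform X) :=
  [set th | pover B th /\ psat v th].

Definition restrict X (p : set (pform X)) (B : set M) : set (pform X) :=
  [set th | p th /\ pover B th].

Definition automorphism (s : M -> M) : Prop :=
  [/\ bijective s,
      forall f a, s (fint M f a) = fint M f (s \o a)
    & forall r a, rint M r a <-> rint M r (s \o a)].

(* The cardinal kappa of the monster model is given as the cardinality of a
   type K. *)
Variable K : Type.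

Definition small (U : Type) (B : set U) : Prop := ~ ([set: K] #<= B)%card.

Definition strong_limit : Prop :=
  forall B : set K, small B -> small [set C : set K | C `<=` B].

Definition saturated : Prop :=
  forall (B : set M) (p : set (pform unit)), small B -> complete_type B p ->
    exists v : unit -> M, realizes v p.

Definition strongly_homogeneous : Prop :=
  forall (X : Type) (a b : X -> M), small [set: X] -> tp a set0 = tp b set0 ->
    exists2 s, automorphism s & s \o a = b.

(* As |form L nat| = |L| + aleph_0, the second clause says |T| < kappa. *)
Definition monster : Prop :=
  [/\ strong_limit, small [set: form L nat], saturated & strongly_homogeneous].

Definition fdivides X (A : set M) (th : pform X) : Prop :=
  exists (k : nat) (b : nat -> 'I_(parity th) -> M),
    (forall i, tp (b i) A = tp (ppar th) A) /\
    (forall s : 'I_k -> nat, injective s ->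
      ~ exists v : X -> M, forall j, psat v (PForm (pmat th) (b (s j)))).

(* The set of formulas pi implies the disjunction of the delta_j. Implication is
   modulo the elementary diagram of M: it has to be witnessed by a finite part of
   pi, since pi may be a global type, which has in general no realization in M. *)
Definition implies_or X (pi : set (pform X)) d (delta : 'I_d -> pform X) : Prop :=
  exists (n : nat) (th : 'I_n -> pform X), (forall i, pi (th i)) /\
    forall v : X -> M, (forall i, psat v (th i)) -> exists j, psat v (delta j).

Definition divides X (A : set M) (pi : set (pform X)) : Prop :=
  exists2 delta : pform X, fdivides A delta & implies_or pi (fun _ : 'I_1 => delta).

Definition forks X (A : set M) (pi : set (pform X)) : Prop :=
  exists (d : nat) (delta : 'I_d -> pform X),
    (forall j, fdivides A (delta j)) /\ implies_or pi delta.

Definition indep X (x : X -> M) (A B : set M) : Prop := ~ forks A (tp x (A `|` B)).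

Definition extension_base (A : set M) : Prop :=
  forall (X : Type) (p : set (pform X)), small [set: X] ->
    complete_type A p -> ~ forks A p.

Definition enum_tuple (D : set M) (x : {m : M | D m}) : M := sval x.

Definition strict_indep X (x : X -> M) (A B : set M) : Prop :=
  exists s : set (pform X),
    [/\ complete_type [set: M] s,
        tp x (A `|` B) `<=` s,
        ~ forks A s
      & forall (D : set M) (c : X -> M), small D -> A `|` B `<=` D ->
          realizes c (restrict s D) ->
          ~ divides A (tp (@enum_tuple D) (A `|` range c))].

Section Sequences.
Context (d : Order.disp_t) (I : orderType d) (X : Type).
Implicit Types (a : I -> X -> M) (A : set M).

Definition subseq_tuple a n (s : 'I_n -> I) (z : 'I_n * X) : M := a (s z.1) z.2.

Definition increasing n (s : 'I_n -> I) : Prop :=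
  forall i j : 'I_n, (i < j)%N -> (s i < s j)%O.

Definition indiscernible A a : Prop :=
  forall n (s t : 'I_n -> I), increasing s -> increasing t ->
    tp (subseq_tuple a s) A = tp (subseq_tuple a t) A.

Definition indiscernible_set A a : Prop :=
  forall n (s t : 'I_n -> I), injective s -> injective t ->
    tp (subseq_tuple a s) A = tp (subseq_tuple a t) A.

Definition before a (i : I) : set M :=
  [set m | exists j x, (j < i)%O /\ m = a j x].

Definition morley A (r : set (pform X)) a : Prop :=
  [/\ indiscernible A a, forall i, realizes (a i) r
    & forall i, indep (a i) A (before a i)].

Definition strict_morley A a : Prop :=
  indiscernible A a /\ forall i, strict_indep (a i) A (before a i).

(* Index sets of sequences. Infiniteness matters: a sequence of length 1 would be
   an indiscernible set for trivial reasons. *)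
Definition small_infinite : Prop := small [set: I] /\ infinite_set [set: I].

End Sequences.

Definition generically_stable X (A : set M) (p : set (pform X)) : Prop :=
  exists (d : Order.disp_t) (I : orderType d) (a : I -> X -> M),
    [/\ small_infinite I, morley A p a & indiscernible_set A a].

Definition co_dominated X Y (A : set M) (q : set (pform Y)) (p : set (pform X)) :
    Prop :=
  exists (a : Y -> M) (b : X -> M), [/\ realizes a q, realizes b p
    & forall (Z : Type) (c : Z -> M), small [set: Z] ->
        indep c A (range b) -> indep c A (range a)].

End Types.

(* Main.v *)
(** Let [b_0, b_1, ...] be a Morley sequence in the generically stable type [p].
    By NIP it has an average, a global type over which the sequence "converges";
    the average does not fork over [A], and by invariance of nonforking types
    along indiscernible sequences it depends only on the strong type of the
    sequence.  Consequently, if all [b_i] have the same type over [A d], then [d]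
    is free from [b_0]: an independent copy [d'] of [d] of the same strong type
    cannot distinguish the [b_i] either, and so [d' b_0] and [d b_0] have the same
    type.

    Now let [c] realize [q], let [b] co-dominate [c], and suppose that [c] is free
    from [d].  Take copies [c_0, c_1, ...] of [c] over [A d], each free from [d]
    and from what was constructed before.  Freeness of [c_n] from the previous
    [b_i], which form an indiscernible set, allows one to choose [b_n] above [c_n]
    so that [b_0, ..., b_n] is again part of a Morley sequence in [p].  After
    passing to a sequence [(b_n, c_n)] indiscernible over [A d], the first part
    shows that [d] is free from [b_0], hence from [c_0] by co-domination, hence
    from [c].  This symmetry is exactly what strictness of a Morley sequence in
    [q] asks for. *)
Require Import Defs.
From Stdlib Require Import List.
From mathcomp Require Import all_boot all_order zify.
From mathcomp Require Import boolp classical_sets functions cardinality filter.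

Set Implicit Arguments.
Unset Strict Implicit.
Unset Printing Implicit Defensive.

Local Open Scope classical_set_scope.

(** * Formulas and renaming *)

(** The obstacle is that freeness from the past is available only for [c_n], whereas [b_n] must be
    chosen above [c_n] and still continue the chain of the earlier [b_i]. Two facts bridge the gap.
    Since [c_n] realizes a nonforking type over the earlier terms, these stay an indiscernible set
    over [A c_n], so a fresh sequence realizing their average has their type over [A c_n]. And the
    given Morley sequence above [c_n] has that same average, so its first term fits in front of the
    fresh sequence and can be carried along when the latter is moved onto the chain. Equality of
    strong types is used only in a concrete form: being two terms of one [A]-indiscernible sequence.
    NIP acts twice, as bounded alternation (a nonforking type is constant along indiscernible
    sequences) and as a bound on how an indiscernible set can be cut (averages exist). The extension
    base supplies the independent copy of [d] together with the whole Morley sequence. *)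

Section Renaming.
Variable L : language.

Fixpoint trename V W (f : V -> W) (t : term L V) : term L W :=
  match t with
  | TVar x => TVar L (f x)
  | TApp g ts => TApp (fun i => trename f (ts i))
  end.

Fixpoint rename V W (f : V -> W) (phi : form L V) : form L W :=
  match phi with
  | FBot => FBot L W
  | FEq s t => FEq (trename f s) (trename f t)
  | FRel r ts => FRel (fun i => trename f (ts i))
  | FImp phi psi => FImp (rename f phi) (rename f psi)
  | FAll phi => FAll (rename (omap f) phi)
  end.

Variable M : structure L.

Lemma eval_rename V W (f : V -> W) (v : W -> M) (t : term L V) :
  eval v (trename f t) = eval (v \o f) t.
Proof.
by elim: t => [x|g ts IH] //=; congr fint; apply/funext => i; exact: IH.
Qed.

Lemma sat_rename V (phi : form L V) : forall W (f : V -> W) (v : W -> M),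
  sat v (rename f phi) <-> sat (v \o f) phi.
Proof.
elim: V / phi => /= [V|V s t|V r ts|V phi IH1 psi IH2|V phi IH] W f v //.
- by rewrite !eval_rename.
- have -> // : (fun i => eval v (trename f (ts i))) = fun i => eval (v \o f) (ts i).
  by apply/funext => i; rewrite eval_rename.
- by rewrite IH1 IH2.
- split=> h m; have := h m; rewrite IH;
    suff -> : scons m v \o omap f = scons m (v \o f) by [].
  + by apply/funext => -[].
  + by apply/funext => -[].
Qed.

Lemma eval_support V (t : term L V) : exists s : list V, forall v w : V -> M,
  (forall x, In x s -> v x = w x) -> eval v t = eval w t.
Proof.
elim: t => [x|g ts IH]; first by exists [:: x] => v w h /=; apply: h; left.
have [s hs] := choice IH.
exists (List.flat_map s (enum 'I_(farity g))) => v w h /=.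
congr fint; apply/funext => i; apply: hs => x xs; apply: h.
apply/in_flat_map; exists i; split => //.
have : i \in enum 'I_(farity g) by rewrite mem_enum.
elim: (enum _) => //= j l IHl; rewrite in_cons => /orP[/eqP ->|/IHl]; tauto.
Qed.

(** A formula is a finite object even when [V] is infinite. One direction is enough because [v] and
    [w] can be exchanged, which the case of an implication exploits. *)
Lemma sat_support V (phi : form L V) : exists s : list V, forall v w : V -> M,
  (forall x, In x s -> v x = w x) -> sat v phi -> sat w phi.
Proof.
elim: V / phi => /= [V|V a b|V r ts|V phi [s hs] psi [s' hs']|V phi [s hs]].
- by exists [::].
- have [s hs] := eval_support a; have [s' hs'] := eval_support b.
  exists (s ++ s')%list => v w h.
  by rewrite (hs v w) ?(hs' v w) // => x xs; apply: h; apply/in_or_app; tauto.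
- have [s hs] := choice (fun i => eval_support (ts i)).
  exists (List.flat_map s (enum 'I_(rarity r))) => v w h /=.
  have -> // : (fun i => eval v (ts i)) = fun i => eval w (ts i).
  apply/funext => i; apply: hs => x xs; apply: h.
  apply/in_flat_map; exists i; split => //.
  have : i \in enum 'I_(rarity r) by rewrite mem_enum.
  elim: (enum _) => //= j l IHl; rewrite in_cons => /orP[/eqP ->|/IHl]; tauto.
- exists (s ++ s')%list => v w h imp h1.
  apply: (hs' v w) => [x xs|]; first by apply: h; apply/in_or_app; tauto.
  apply: imp; apply: (hs w v) => // x xs.
  by rewrite h //; apply/in_or_app; tauto.
- exists (List.flat_map (fun o => if o is Some x then [:: x] else [::]) s).
  move=> v w h hv m; apply: (hs (scons m v)) => // -[x|] xs //=; apply: h.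
  by apply/in_flat_map; exists (Some x); split => //; left.
Qed.

Lemma eval_aut (s : M -> M) V (v : V -> M) (t : term L V) :
  automorphism s -> eval (s \o v) t = s (eval v t).
Proof.
case=> _ hf _; elim: t => [x|g ts IH] //=; rewrite hf; congr fint.
by apply/funext => i; exact: IH.
Qed.

Lemma sat_aut (s : M -> M) V (phi : form L V) : automorphism s ->
  forall v, sat (s \o v) phi <-> sat v phi.
Proof.
move=> hs; elim: V / phi => /= [V|V a b|V r ts|V phi IH1 psi IH2|V phi IH] v //.
- rewrite !eval_aut //; split=> [|-> //]; case: hs => /bij_inj + _ _; exact.
- case: (hs) => _ _ /(_ r (fun i => eval v (ts i))) ->.
  have -> // : (fun i => eval (s \o v) (ts i)) = s \o (fun i => eval v (ts i)).
  by apply/funext => i; rewrite eval_aut.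
- by rewrite IH1 IH2.
- have e m : scons (s m) (s \o v) = s \o scons m v by apply/funext => -[].
  split=> h m; first by apply/IH; rewrite -e; exact: h.
  case: (hs) => -[t _ ts] _ _; rewrite -(ts m) e; exact/IH.
Qed.

(** The bridge from tuples indexed by arbitrary types to the finite tuples demanded by [pform],
    [fdivides] and [has_IP]. *)
Lemma sat_finite V W (phi : form L (V + W)) : exists n (g : 'I_n -> W)
    (psi : form L (V + 'I_n)), forall (v : V -> M) (w : W -> M),
  sat (copair v w) phi <-> sat (copair v (w \o g)) psi.
Proof.
have [s hs] := sat_support phi.
pose s' := List.flat_map (fun z : V + W => if z is inr y then [:: y] else [::]) s.
have [[w0]|noW] := pselect (inhabited W); last first.
  pose f (z : V + W) : V + 'I_0 :=
    match z with inl x => inl x | inr y => False_rect _ (noW (inhabits y)) end.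
  have g (i : 'I_0) : W by case: i.
  exists 0, g, (rename f phi) => v w; rewrite sat_rename.
  suff -> : copair v (w \o g) \o f = copair v w by [].
  by apply/funext => -[x|y] //=; case: (noW (inhabits y)).
(* Putting [w0] in front makes [ord0] available as a dummy index for the variables that do not
   occur; this is why an empty [W] is treated apart. *)
pose l := w0 :: s'; pose n := size l.
pose g (i : 'I_n) := nth w0 l i.
have hk y : exists i : 'I_n, In y l -> g i = y.
  have [yl|nyl] := pselect (In y l); last by exists ord0.
  have [i [il iy]] := In_nth l y w0 yl.
  have il' : i < n by apply/ltP.
  exists (Ordinal il') => _; rewrite /g /= -iy.
  by elim: (l) (i) {il iy yl il'} => [|a t IH] [|j] //=.
have [k kP] := choice hk.
exists n, g, (rename (fun z => match z with inl x => inl x | inr y => inr (k y) end) phi).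
move=> v w; rewrite sat_rename.
have e z : In z s -> copair v w z =
    (copair v (w \o g) \o fun z => match z with inl x => inl x | inr y => inr (k y) end) z.
  case: z => [x|y] //= zs; congr w; rewrite kP // /l; right.
  by apply/in_flat_map; exists (inr y); split => //; left.
by split; apply: hs => z zs; rewrite e.
Qed.

End Renaming.

(** * Definable sets and types *)

Section Definable.
Variables (L : language) (M : structure L).

(** Parameters are variables indexed by the elements of [B], so that formulas combine without
    merging finite parameter tuples; [def_pform] recovers a finite tuple. *)
Definition definable (B : set M) X (P : set (X -> M)) : Prop :=
  exists phi : form L (X + {m : M | B m}), forall v, P v <-> sat (copair v sval) phi.

Definition eqtp (B : set M) X (a b : X -> M) : Prop :=
  forall P, definable B P -> P a -> P b.

Lemma def_ext (B : set M) X (P Q : set (X -> M)) :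
  (forall v, P v <-> Q v) -> definable B P -> definable B Q.
Proof. by move=> PQ [phi h]; exists phi => v; rewrite -PQ. Qed.

Lemma def_imp (B : set M) X (P Q : set (X -> M)) :
  definable B P -> definable B Q -> definable B (fun v => P v -> Q v).
Proof.
move=> [phi hphi] [psi hpsi]; exists (FImp phi psi) => v /=.
by rewrite -hphi -hpsi.
Qed.

Lemma def_const (B : set M) X (p : Prop) : definable B (fun v : X -> M => p).
Proof.
have [hp|hp] := pselect p; last by exists (FBot _ _) => v /=; tauto.
by exists (FImp (FBot _ _) (FBot _ _)) => v /=; tauto.
Qed.

Lemma def_not (B : set M) X (P : set (X -> M)) :
  definable B P -> definable B (~` P).
Proof. by move=> hP; exact: (def_imp hP (@def_const B X False)). Qed.

Lemma def_and (B : set M) X (P Q : set (X -> M)) :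
  definable B P -> definable B Q -> definable B (P `&` Q).
Proof.
move=> hP hQ; apply: (def_ext (P := ~` (fun v => P v -> (~` Q) v))).
  move=> v; split=> [h|[Pv Qv] /(_ Pv)]; last by [].
  by apply: contrapT => n; apply: h => Pv Qv; apply: n.
exact/def_not/def_imp/def_not.
Qed.

Lemma def_forall (B : set M) X I (l : list I) (P : I -> set (X -> M)) :
  (forall i, definable B (P i)) ->
  definable B (fun v => forall i, In i l -> P i v).
Proof.
move=> hP; elim: l => [|i l IH].
  by apply: (def_ext _ (@def_const B X True)) => v; split.
apply: (def_ext _ (def_and (hP i) IH)) => v; split=> [[h1 h2] j [<-|] //|h].
  exact: h2.
by split=> [|j hj]; apply: h => /=; tauto.
Qed.

Lemma def_forall_ord (B : set M) X n (P : 'I_n -> set (X -> M)) :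
  (forall i, definable B (P i)) -> definable B (fun v => forall i, P i v).
Proof.
move=> hP; apply: (def_ext _ (def_forall (enum 'I_n) hP)) => v.
split=> h i; last by move=> _; exact: h.
apply: h; have : i \in enum 'I_n by rewrite mem_enum.
by elim: (enum _) => //= j l IHl; rewrite in_cons => /orP[/eqP ->|/IHl]; tauto.
Qed.

Lemma def_plug (B B' : set M) X Y (P : set (X -> M)) (h : X -> Y + {m | B' m}) :
  B `<=` B' -> definable B P ->
  definable B' (fun v : Y -> M => P (fun x => copair v sval (h x))).
Proof.
move=> BB' [phi hphi].
exists (rename (fun z => match z with
  inl x => h x | inr b => inr (exist _ (sval b) (BB' _ (svalP b))) end) phi) => v.
rewrite sat_rename hphi.
suff -> : copair (fun x => copair v sval (h x)) sval = copair v sval \o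
  (fun z : X + {m | B m} => match z with
    inl x => h x | inr b => inr (exist _ (sval b) (BB' _ (svalP b))) end) by [].
by apply/funext => -[].
Qed.

Lemma def_mono (B B' : set M) X (P : set (X -> M)) :
  B `<=` B' -> definable B P -> definable B' P.
Proof. by move=> BB' /(def_plug (fun x => inl x) BB'). Qed.

Lemma def_comp (B : set M) X Y (f : X -> Y) (P : set (X -> M)) :
  definable B P -> definable B (fun v => P (v \o f)).
Proof. by move=> hP; exact: (def_plug (fun x => inl (f x)) (@subset_refl _ B) hP). Qed.

Lemma def_fiber (B B' : set M) X W (Q : set (X + W -> M)) (w : W -> M) :
  B `<=` B' -> (forall x, B' (w x)) -> definable B Q ->
  definable B' (fun v => Q (copair v w)).
Proof.
move=> BB' hw hQ.
have := def_plug (fun z => match z with inl x => inl x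
  | inr y => inr (exist _ (w y) (hw y)) end) BB' hQ.
apply: def_ext => v.
suff -> : copair v w = (fun x : X + W => copair v sval
   (match x with inl x => inl x | inr y => inr (exist _ (w y) (hw y)) end)) by [].
by apply/funext => -[].
Qed.

Lemma def_split (B : set M) X W (P : set (X -> M)) (w : W -> M) :
  definable (B `|` range w) P ->
  exists2 Q : set (X + W -> M), definable B Q & forall v, P v <-> Q (copair v w).
Proof.
move=> [phi hphi].
have hk (z : {m | (B `|` range w) m}) : exists k : {m | B m} + W, copair sval w k = sval z.
  by case: z => m /= [Bm|[y _ <-]]; [exists (inl (exist _ m Bm))|exists (inr y)].
have [k kP] := choice hk.
pose phi' := rename (fun z => match z with inl x => inl (inl x)
  | inr b => match k b with inl c => inr c | inr y => inl (inr y) end end) phi.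
exists (fun u => sat (copair u sval) phi'); first by exists phi'.
move=> v; rewrite hphi sat_rename.
set g := (X in _ \o X); suff -> : copair v sval = copair (copair v w) sval \o g by [].
by apply/funext => -[x|b] //=; rewrite -kP; case: (k b).
Qed.

Lemma def_psat (B : set M) X (th : pform M X) :
  pover B th -> definable B (fun v => psat v th).
Proof.
move=> hB; have := @def_fiber set0 B X _ (fun u => sat u (pmat th)) (@ppar L M X th).
move=> /(_ (sub0set _) hB); apply; exists (rename inl (pmat th)) => v.
by rewrite sat_rename.
Qed.

Lemma def_pform (B : set M) X (P : set (X -> M)) : definable B P ->
  exists2 th : pform M X, pover B th & forall v, P v <-> psat v th.
Proof.
move=> [phi hphi]; have [n [g [psi h]]] := sat_finite M phi.
exists (PForm psi (sval \o g)) => [i|v]; first exact: svalP.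
by rewrite hphi h.
Qed.

Lemma def_support (B : set M) X (P : set (X -> M)) : definable B P ->
  exists s : list X, forall v w, (forall x, In x s -> v x = w x) -> P v -> P w.
Proof.
move=> [phi hphi]; have [s hs] := sat_support M phi.
exists (List.flat_map (fun z => if z is inl x then [:: x] else [::]) s) => v w h.
rewrite !hphi; apply: hs => -[x|b] //= xs; apply: h.
by apply/in_flat_map; exists (inl x); split => //; left.
Qed.

(** Projection along finitely many coordinates, one quantifier at a time. It serves to eliminate the
    coordinates that a partial realization has not fixed yet. *)
Lemma def_exists (B : set M) X (P : set (X -> M)) (t : list X) : definable B P ->
  definable B (fun v => exists2 w, forall x, ~ In x t -> w x = v x & P w).
Proof.
elim: t P => [|y t IH] P hP.
  apply: (def_ext _ hP) => v; split=> [Pv|[w h Pw]]; first by exists v.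
  by suff <- : w = v by []; apply/funext => x; exact: h.
pose upd m (v : X -> M) x := if pselect (x = y) then m else v x.
have hQ : definable B (fun v => exists m, P (upd m v)).
  case: hP => phi hphi.
  pose f (z : X + {m | B m}) : option (X + {m | B m}) := match z with
    inl x => if pselect (x = y) then None else Some (inl x) | inr b => Some (inr b) end.
  exists (FNot (FAll (FNot (rename f phi)))) => v /=.
  have e m : sat (scons m (copair v sval)) (rename f phi) <-> P (upd m v).
    rewrite sat_rename hphi.
    suff -> : scons m (copair v sval) \o f = copair (upd m v) sval by [].
    by apply/funext => -[x|b] //=; rewrite /upd; case: pselect.
  split=> [[m Pm] h|h]; first by apply: (h m); rewrite e.
  by apply: contrapT => n; apply: h => m; rewrite e => Pm; apply: n; exists m.
apply: (def_ext _ (IH _ hQ)) => v; split=> [[w h [m Pm]]|[w h Pw]].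
  exists (upd m w) => // x nx; rewrite /upd; case: (pselect (x = y)) => [xy|nxy].
    by case: nx; left.
  by apply: h => xt; apply: nx; right.
exists (upd (v y) w); last first.
  exists (w y); suff -> : upd (w y) (upd (v y) w) = w by [].
  by apply/funext => x; rewrite /upd; case: (pselect (x = y)) => [e|ne] /=; rewrite ?e.
move=> x nx; rewrite /upd; case: (pselect (x = y)) => [e|xy] /=; first by rewrite e.
by apply: h => -[/esym|].
Qed.

Lemma eqtp_sym (B : set M) X (a b : X -> M) : eqtp B a b -> eqtp B b a.
Proof.
move=> h P hP Pb; apply: contrapT => Pa.
exact: (h (~` P) (def_not hP) Pa).
Qed.

Lemma eqtp_trans (B : set M) X (a b c : X -> M) : eqtp B a b -> eqtp B b c -> eqtp B a c.
Proof. by move=> ab bc P hP /(ab P hP); exact: bc. Qed.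

Lemma eqtp_mono (B B' : set M) X (a b : X -> M) : B `<=` B' -> eqtp B' a b -> eqtp B a b.
Proof. by move=> BB' h P hP; apply: h; exact: def_mono hP. Qed.

Lemma eqtp_comp (B : set M) X Y (f : Y -> X) (a b : X -> M) :
  eqtp B a b -> eqtp B (a \o f) (b \o f).
Proof. by move=> h P hP; exact: (h _ (def_comp f hP)). Qed.

Lemma eqtp_finite (B : set M) X (a b : X -> M) :
  (forall s : list X, exists a' b', [/\ eqtp B a' b',
     forall x, In x s -> a x = a' x & forall x, In x s -> b x = b' x]) -> eqtp B a b.
Proof.
move=> h P hP Pa; have [s hs] := def_support hP.
have [a' [b' [ab ha hb]]] := h s.
apply: (hs b') => [x xs|]; first by rewrite hb.
by apply: ab => //; exact: (hs a).
Qed.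

Lemma eqtp_add (B : set M) X W (a b : X -> M) (w : W -> M) :
  eqtp (B `|` range w) a b <-> eqtp B (copair a w) (copair b w).
Proof.
split=> h P hP Pa.
  have hP' := def_fiber (@subsetUl _ B (range w)) (fun x => or_intror (imageT w x)) hP.
  exact: (h _ hP').
have [Q hQ e] := def_split hP; apply/e; apply: h => //; exact/e.
Qed.

Lemma tpP (B : set M) X (a b : X -> M) : tp a B = tp b B <-> eqtp B a b.
Proof.
split=> [e P hP|h].
  have [th ov e'] := def_pform hP; rewrite !e' => pa.
  by have : tp a B th by []; rewrite e => -[].
have hs := eqtp_sym h.
apply/seteqP; split=> th [ov pa]; split=> //.
  exact: (h _ (def_psat ov) pa).
exact: (hs _ (def_psat ov) pa).
Qed.

Lemma realizes_eqtp (B : set M) X (r : set (pform M X)) (a b : X -> M) :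
  complete_type B r -> realizes a r -> realizes b r <-> eqtp B a b.
Proof.
move=> [rB _ rc] ra; split=> [rb P /def_pform[th ov e] |ab th rth].
  by rewrite !e => pa; have [/rb//|/ra npa] := rc _ ov; case: (npa pa).
exact: (ab _ (def_psat (rB _ rth)) (ra _ rth)).
Qed.

End Definable.

(** * Cardinalities *)

(** Comparability of cardinals: a maximal partial injection, found by Zorn's lemma, is total or
    onto, since otherwise an unmatched pair could be added. *)
Lemma rel_total U V (A : set U) (B : set V) :
  exists R : U -> V -> Prop,
  [/\ forall u v, R u v -> A u /\ B v, forall u v v', R u v -> R u v' -> v = v',
      forall u u' v, R u v -> R u' v -> u = u'
    & (forall u, A u -> exists v, R u v) \/ (forall v, B v -> exists u, R u v)].
Proof.
pose ok (G : set (U * V)) := [/\ forall z, G z -> A z.1 /\ B z.2,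
  forall u v v', G (u, v) -> G (u, v') -> v = v' &
  forall u u' v, G (u, v) -> G (u', v) -> u = u'].
have [|G [[G1 G2 G3] maxG]] := @Zorn_bigcup _ ok.
  move=> C Cok Ctot.
  have dir z z' : (\bigcup_(X in C) X) z -> (\bigcup_(X in C) X) z' ->
      exists2 G, C G & G z /\ G z'.
    move=> [G1 C1 z1] [G2 C2 z2]; have [h|h] := Ctot _ _ C1 C2.
      by exists G2 => //; split => //; exact: h.
    by exists G1 => //; split => //; exact: h.
  split=> [z [G CG Gz]|u v v' h h'|u u' v h h'].
  - by have [h _ _] := Cok _ CG; exact: h.
  - have [G CG [g g']] := dir _ _ h h'; have [_ + _] := Cok _ CG; apply; eassumption.
  - have [G CG [g g']] := dir _ _ h h'; have [_ _ +] := Cok _ CG; apply; eassumption.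
exists (fun u v => G (u, v)); split => // [u v /G1 //|].
apply: contrapT => /not_orP[/existsNP[u /not_implyP[Au nu]] /existsNP[v /not_implyP[Bv nv]]].
apply: (maxG (G `|` [set (u, v)])).
  split=> [z Gz|/(_ (u, v) (or_intror erefl)) Guv]; first by left.
  by apply: nu; exists v.
split=> [z [/G1 //|->//]|u1 v1 v2|u1 u2 v1].
- move=> [h1|[e1 e2]] [h2|[f1 f2]]; subst=> //; first exact: G2 h1 h2.
    by case: nu; exists v1.
  by case: nu; exists v2.
- move=> [h1|[e1 e2]] [h2|[f1 f2]]; subst=> //; first exact: G3 h1 h2.
    by case: nv; exists u1.
  by case: nv; exists u2.
Qed.

Section Small.
Variable K : Type.

Lemma smallP U (B : set U) :
  small K B <-> ~ exists f : K -> U, injective f /\ forall k, B (f k).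
Proof.
rewrite /small; apply: not_iff_compat; split=> [/card_leP[f]|[f [finj fB]]].
  pose g k := f (SigSub (mem_set (I : [set: K] k))).
  exists (val \o g); split=> [k k' /= /val_inj e|k]; last exact: set_mem (valP (g k)).
  have /(_ _ _)/(congr1 val) := @inj _ _ _ f _ _ _ _ e.
  by apply; rewrite inE.
have [h] : $|{injfun [set: K] >-> B}|.
  by apply/injfunPex; exists f => // k k' _ _; exact: finj.
exact: inj_card_le.
Qed.

Lemma small_rel U V (B : set U) (C : set V) (R : V -> U -> Prop) : small K B ->
  (forall c, C c -> exists b, B b /\ R c b) ->
  (forall c c' b, C c -> C c' -> R c b -> R c' b -> c = c') -> small K C.
Proof.
rewrite !smallP => nB tot inj [f [finj fC]]; apply: nB.
have [g gP] := choice (fun k => tot _ (fC k)).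
exists g; split=> [k k' e|k]; last by have [] := gP k.
apply: finj; apply: (inj _ _ (g k)) => //; first by have [] := gP k.
by rewrite e; have [] := gP k'.
Qed.

Lemma small_sub U (B C : set U) : C `<=` B -> small K B -> small K C.
Proof.
move=> CB sB; apply: (small_rel (R := eq) sB) => [c /CB Bc|c c' b _ _ -> //].
by exists c.
Qed.

Lemma small_image U V (f : U -> V) (B : set U) : small K B -> small K (f @` B).
Proof.
move=> sB; apply: (small_rel (R := fun v u => f u = v) sB) => [_ [u Bu <-]|c c' b _ _ <- <- //].
by exists u.
Qed.

Lemma small_inj U V (f : U -> V) (B : set V) (C : set U) :
  injective f -> (forall u, C u -> B (f u)) -> small K B -> small K C.
Proof.
move=> finj fB sB.
apply: (small_rel (R := fun v u => f v = u) sB) => [c Cc|c c' b _ _ <- /finj //].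
by exists (f c); split => //; exact: fB.
Qed.

Lemma small_sig U (B : set U) : small K B -> small K [set: {m | B m}].
Proof. by apply: (small_inj (f := sval)) => [[x p] [y q] /= e|[x p]] //; exact: eq_exist. Qed.

Hypothesis (hK : strong_limit K) (hnat : small K [set: nat]).

(** As [strong_limit] speaks of subsets of [K], comparability first transports [B] into [K]; the
    opposite case would inject [K] into the small set [B]. *)
Lemma small_powerset U (B : set U) : small K B -> small K [set C : set U | C `<=` B].
Proof.
move=> sB.
have [R [R1 R2 R3]] := rel_total B [set: K]; case=> [tot|tot]; last first.
  case: (small_rel (R := fun k u => R u k) sB _ _ (card_lexx [set: K])) => [k _|k k' u _ _].
    by have [u Ruk] := tot k I; exists u; have [] := R1 _ _ Ruk.
  exact: R2.
pose h (C : set U) : set K := [set k | exists2 u, C u & R u k].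
have sh : small K [set k | exists u, R u k].
  apply: (small_rel (R := fun k u => R u k) sB) => [k [u Ruk]|k k' u _ _].
    by exists u; have [] := R1 _ _ Ruk.
  exact: R2.
apply: (small_rel (R := fun C D => h C = D) (hK sh)) => [C CB|C C' D CB CB' <- e].
  by exists (h C); split => // k [u _ Ruk]; exists u.
suff sub (C1 C2 : set U) : C1 `<=` B -> h C1 = h C2 -> C1 `<=` C2.
  by apply/seteqP; split; exact: sub.
move=> C1B e12 u C1u; have [k Ruk] := tot _ (C1B _ C1u).
have : h C1 k by exists u.
by rewrite e12 => -[u' C2u' /(R3 _ _ _ Ruk) ->].
Qed.

(** Kuratowski pairs embed the square into the double power set, so the strong limit property
    replaces cardinal arithmetic. *)
Lemma small_square U (B : set U) : small K B -> small K (B `*` B).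
Proof.
move=> /small_powerset/small_powerset sB.
apply: (small_rel (R := fun z D => D = [set [set z.1]; [set z.1; z.2]]) sB).
  move=> [x y] [/= Bx By]; eexists; split; last reflexivity.
  by move=> C [->|->] z; [move=> ->|case=> ->].
move=> [x y] [x' y'] D _ _ /= -> e.
have ex : x = x'.
  have : [set [set x']; [set x'; y']] [set x] by rewrite -e; left.
  case=> e1; first by have : [set x'] x by rewrite -e1.
  by have : [set x] x' by rewrite e1; left.
subst x'; congr pair.
have h : [set [set x]; [set x; y']] [set x; y] by rewrite -e; right.
have h' : [set [set x]; [set x; y]] [set x; y'] by rewrite e; right.
case: h => e1; last first.
  have : [set x; y'] y by rewrite -e1; right.
  case=> [yx|//]; have {yx}ex : y = x := yx; subst y; have : [set x; x] y' by rewrite e1; right.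
  by case=> ->.
have yx : y = x by change ([set x] y); rewrite -e1; right.
subst y; case: h' => e2; first by have -> : [set x] y' by rewrite -e2; right.
by have : [set x; x] y' by [rewrite -e2; right]; case=> ->.
Qed.

Lemma small_setX U V (A : set U) (B : set V) :
  small K A -> small K B -> small K (A `*` B).
Proof.
move=> sA sB; have [R [R1 R2 R3]] := rel_total A B; case=> tot.
  apply: (small_rel (R := fun z w => R z.1 w.1 /\ z.2 = w.2) (small_square sB)).
    move=> [x y] [/= Ax By]; have [v Rxv] := tot _ Ax; exists (v, y).
    by have [] := R1 _ _ Rxv.
  by move=> [x y] [x' y'] [b b'] _ _ /= [r ->] [r' ->]; rewrite (R3 _ _ _ r r').
apply: (small_rel (R := fun z w => z.1 = w.1 /\ R w.2 z.2) (small_square sA)).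
  move=> [x y] [/= Ax By]; have [v Rxv] := tot _ By; exists (x, v).
  by have [] := R1 _ _ Rxv.
by move=> [x y] [x' y'] [b b'] _ _ /= [-> r] [-> r']; rewrite (R2 _ _ _ r r').
Qed.

Lemma small_prod U V : small K [set: U] -> small K [set: V] -> small K [set: U * V].
Proof. by move=> sU sV; apply: small_sub (small_setX sU sV) => -[]. Qed.

Lemma small_setU U (A B : set U) : small K A -> small K B -> small K (A `|` B).
Proof.
move=> /small_powerset sA /small_powerset sB.
apply: (small_rel (R := fun x D => D = ([set x] `&` A, [set x] `&` B)) (small_setX sA sB)).
  by move=> x _; exists ([set x] `&` A, [set x] `&` B); split=> //; split=> y [].
move=> x y D h _ -> [e1 e2]; case: h => [Ax|Bx].
  by have [] : ([set y] `&` A) x by rewrite -e1.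
by have [] : ([set y] `&` B) x by rewrite -e2.
Qed.

Lemma small_sum U V : small K [set: U] -> small K [set: V] -> small K [set: U + V].
Proof.
move=> /(small_image (f := @inl U V)) sU /(small_image (f := @inr U V)) sV.
by apply: small_sub (small_setU sU sV) => -[x|x] _; [left|right]; exists x.
Qed.

Lemma small_ord n : small K [set: 'I_n].
Proof. exact: (small_inj (@ord_inj n) (fun _ _ => I) hnat). Qed.

End Small.

Lemma monster_nat L (M : structure L) K : monster M K -> small K [set: nat].
Proof.
case=> _ + _ _; apply: (small_inj (f := fun n => FEq (TVar L 0) (TVar L n))) => //.
by move=> n m [].
Qed.

(** * Saturation and homogeneity *)

Section Monster.
Variables (L : language) (M : structure L) (K : Type).
Hypothesis hM : monster M K.

Let hnat : small K [set: nat] := monster_nat hM.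
Let hSL : strong_limit K. Proof. by case: hM. Qed.

(** * Realizing types in a small tuple of variables *)

Section Realization.
Variables (X : Type) (B : set M) (F : set_system (X -> M)).
Hypotheses (sX : small K [set: X]) (sB : small K B) (pF : ProperFilter F).

Let ok (G : set (X * M)) := forall P, definable B P -> F P ->
  exists2 v : X -> M, forall x m, G (x, m) -> v x = m & P v.

Let ok_fun G x m m' : ok G -> G (x, m) -> G (x, m') -> m = m'.
Proof.
move=> okG h h'; have [|v hv _] := okG _ (@def_const _ _ B X True); first exact: filterT.
by rewrite -(hv _ _ h) -(hv _ _ h').
Qed.

Let ok_bigcup (C : set (set (X * M))) :
  C `<=` ok -> total_on C subset -> ok (\bigcup_(G in C) G).
Proof.
move=> Cok Ctot P dP FP.
have [[G0 CG0]|noC] := pselect (exists G, C G); last first.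
  have [v Pv] := filter_ex FP; exists v => // x m [G CG].
  by case: noC; exists G.
have dir G1 G2 : C G1 -> C G2 -> exists2 G, C G & G1 `<=` G /\ G2 `<=` G.
  move=> C1 C2; have [h|h] := Ctot _ _ C1 C2.
    by exists G2 => //; split=> //.
  by exists G1 => //; split=> //.
pose U := \bigcup_(G in C) G.
have Ufun x m m' : U (x, m) -> U (x, m') -> m = m'.
  move=> [G1 C1 z1] [G2 C2 z2]; have [G CG [h1 h2]] := dir _ _ C1 C2.
  exact: (ok_fun (Cok _ CG) (h1 _ z1) (h2 _ z2)).
(* Only finitely many assigned coordinates matter to [P], and one member of the chain already
   assigns all of them. *)
have [s hs] := def_support dP.
have [G CG hG] : exists2 G, C G & forall x m, In x s -> U (x, m) -> G (x, m).
  elim: (s) => [|y l [G CG IH]]; first by exists G0.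
  have [[m [G' CG' ym]]|ny] := pselect (exists m, U (y, m)); last first.
    exists G => // x m [<- Uym|]; last exact: IH.
    by case: ny; exists m.
  have [H CH [h1 h2]] := dir _ _ CG CG'.
  exists H => // x m' [<- Uym'|xl Uxm]; last exact/h1/IH.
  by rewrite (Ufun _ _ m Uym'); [exact: h2|exists G'].
have [v hv Pv] := Cok _ CG _ dP FP.
have hk x : exists m, (U (x, m)) \/ (~ (exists m, U (x, m)) /\ m = v x).
  have [[m h]|h] := pselect (exists m, U (x, m)); first by exists m; left.
  by exists (v x); right.
have [w hw] := choice hk; exists w => [x m Uxm|].
  by have [h|[h _]] := hw x; [exact: Ufun h Uxm|case: h; exists m].
apply: (hs v) => // x xs; have [h|[_ -> //]] := hw x.
by apply: hv; exact: hG.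
Qed.

Lemma filter_realized : exists v : X -> M, forall P, definable B P -> F P -> P v.
Proof.
(* [saturated] realizes types in one variable only. In a maximal assignment [G] compatible with [F],
   an unassigned [x] is impossible: the projections to [x] of the members of [F] generate a filter
   over [B] and the assigned values, and a realization of a complete type extending it would enlarge
   [G]. *)
have [G [okG maxG]] := Zorn_bigcup ok_bigcup.
suff tot x : exists m, G (x, m).
  have [v hv] := choice tot; exists v => P dP FP; have [w hw Pw] := okG _ dP FP.
  by suff -> : v = w by []; apply/funext => x; rewrite (hw _ _ (hv x)).
apply: contrapT => nx.
pose B' := B `|` [set m | exists y, G (y, m)].
have sB' : small K B'.
  apply: small_setU => //.
  apply: (small_rel (R := fun m y => G (y, m)) sX) => [m [y Gy]|m m' y _ _].
    by exists y.
  exact: ok_fun.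
pose T (P : set (X -> M)) (u : unit -> M) :=
  exists2 v : X -> M, (forall y m, G (y, m) -> v y = m) /\ v x = u tt & P v.
have defT P : definable B P -> definable B' (T P).
  (* Coordinates in the support of [P] that are neither assigned nor [x] form [l] and are quantified
     away; assigned ones are replaced by their values, which are parameters in [B']. *)
  move=> dP; have [s hs] := def_support dP.
  have hl : exists l : list X, forall y, In y l <->
      In y s /\ ~ (exists m, G (y, m)) /\ y <> x.
    elim: (s) => [|y r [l IH]]; first by exists [::] => y; split=> // -[].
    have [h|h] := pselect (~ (exists m, G (y, m)) /\ y <> x).
      exists (y :: l) => z /=; rewrite IH; split=> [[<-|]|]; tauto.
    by exists l => z; rewrite IH /=; split=> [|[[e|]]]; [tauto|subst|tauto].
  have [l hl'] := hl.
  have dE := def_exists l dP.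
  have hh y : exists z : unit + {m | B' m},
      forall m, G (y, m) -> exists b, z = inr b /\ sval b = m.
    have [[m Gm]|n] := pselect (exists m, G (y, m)); last first.
      by exists (inl tt) => m Gm; case: n; exists m.
    have b' : B' m by right; exists y.
    exists (inr (exist _ m b')) => m' Gm'; exists (exist _ m b'); split=> //=.
    exact: ok_fun Gm Gm'.
  have [h0 h0P] := choice hh.
  pose h y := if pselect (y = x) then inl tt else h0 y.
  apply: (def_ext _ (def_plug h (@subsetUl _ B _) dE)) => u.
  have hG y m : G (y, m) -> copair u sval (h y) = m.
    move=> Gy; rewrite /h; case: (pselect (y = x)) => [e|e] /=.
      by case: nx; exists m; rewrite -e.
    by have [b [-> <-]] := h0P _ _ Gy.
  have hx : copair u sval (h x) = u tt.
    by rewrite /h; case: (pselect (x = x)).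
  split=> [[w hw Pw]|[v [v1 v2] Pv]].
    exists w => //; split=> [y m Gy|].
      by rewrite hw; [exact: hG|move=> /hl'[_ [n _]]; apply: n; exists m].
    by rewrite hw; [exact: hx|move=> /hl'[_ [_ n]]; exact: n].
  exists (fun y => if pselect (In y l) then v y else copair u sval (h y)).
    by move=> y ny; case: (pselect (In y l)).
  apply: (hs v) => // y ys; case: (pselect (In y l)) => [//|n] /=.
  have [yx|yx] := pselect (y = x); first by rewrite [in RHS]yx hx yx.
  have [[m Gy]|ny] := pselect (exists m, G (y, m)).
    by rewrite (hG _ _ Gy) (v1 _ _ Gy).
  by case: n; apply/hl'.
pose F1 : set_system (unit -> M) := [set S | exists P, [/\ definable B P, F P & T P `<=` S]].
have pF1 : ProperFilter F1.
  split; last split.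
  - move=> [P [dP FP h]]; have [v hv Pv] := okG _ dP FP.
    by apply: (h (fun=> v x)); exists v.
  - by exists setT; split=> //; [exact: (@def_const _ _ B X True)|exact: filterT].
  - move=> S S' [P [dP FP h]] [P' [dP' FP' h']]; exists (P `&` P'); split.
    + exact: def_and.
    + exact: filterI.
    + by move=> u [v hv [Pv P'v]]; split; [apply: h|apply: h']; exists v.
  - by move=> S S' SS' [P [dP FP h]]; exists P; split=> //; exact: subset_trans SS'.
have [F2 [uF2 F12]] := ultraFilterLemma pF1.
pose p : set (pform M unit) := [set th | pover B' th /\ F2 (fun v => psat v th)].
have [u hu] : exists v : unit -> M, realizes v p.
  case: hM => _ _ + _; apply; first exact: sB'.
  split=> [th [] //|n th hth|th ov].
    have : F2 (fun v => forall i, psat v (th i)).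
      by apply: filter_forall => i; have [] := hth i.
    exact: filter_ex.
  by have [h|h] := in_ultra_setVsetC (fun v => psat v th) uF2; [left|right].
apply: (maxG (G `|` [set (x, u tt)])).
  split=> [z Gz|/(_ (x, u tt) (or_intror erefl)) Gx]; first by left.
  by apply: nx; exists (u tt).
move=> P dP FP; have [th ov e] := def_pform (defT P dP).
have [v [v1 v2] Pv] : T P u.
  apply/e; apply: hu; split => //; apply: F12; exists P; split=> // v.
  by rewrite e.
by exists v => // y m [/v1//|[-> ->]].
Qed.

End Realization.

Lemma homogeneity X (B : set M) (a b : X -> M) :
  small K [set: X] -> small K B -> eqtp B a b ->
  exists s, [/\ automorphism s, forall m, B m -> s m = m & s \o a = b].
Proof.
move=> sX sB ab.
(* [strongly_homogeneous] is stated over the empty set, so the elements of [B] become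
   coordinates. *)
have ab' : eqtp set0 (copair a (@sval _ B)) (copair b (@sval _ B)).
  apply/eqtp_add; apply: eqtp_mono ab => m [//|[[m' Bm'] _ <-] //].
have [s sA e] : exists2 s, automorphism s & s \o copair a (@sval _ B) = copair b (@sval _ B).
  case: hM => _ _ _; apply; last exact/tpP.
  by apply: small_sum => //; exact: small_sig.
exists s; split=> // [m Bm|].
  exact: (congr1 (fun f => f (inr (exist _ m Bm))) e).
by apply/funext => x; exact: (congr1 (fun f => f (inl x)) e).
Qed.

Lemma eqtp_aut X (B : set M) (s : M -> M) (a : X -> M) :
  automorphism s -> (forall m, B m -> s m = m) -> eqtp B a (s \o a).
Proof.
move=> sA sB P [phi h]; rewrite !h => sa.
have -> : copair (s \o a) sval = s \o copair a (@sval _ B).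
  by apply/funext => -[x|[m Bm]] //=; rewrite sB.
exact/sat_aut.
Qed.

Lemma eqtp_extend X Z (B : set M) (a b : X -> M) (c : Z -> M) :
  small K [set: X] -> small K B -> eqtp B a b ->
  exists c', eqtp B (copair a c) (copair b c').
Proof.
move=> sX sB /homogeneity[] // s [sA fB <-]; exists (s \o c).
have -> : copair (s \o a) (s \o c) = s \o copair a c by apply/funext => -[].
exact: eqtp_aut.
Qed.

End Monster.

(** * Global types and forking *)

Section Forking.
Variables (L : language) (M : structure L).

(* A global type is represented by a filter of subsets of [X -> M]; only its
   definable members matter. *)
Definition global_type X (F : set_system (X -> M)) : Prop :=
  ProperFilter F /\ forall P, definable setT P -> F P \/ F (~` P).

Definition nonforking X (A : set M) (F : set_system (X -> M)) : Prop :=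
  forall th, fdivides A th -> ~ F (fun v => psat v th).

Definition free X (a : X -> M) (A B : set M) : Prop :=
  exists F : set_system (X -> M), [/\ global_type F, nonforking A F
    & forall P, definable (A `|` B) P -> P a -> F P].

Lemma fdivides_base X (A A' : set M) (th : pform M X) :
  A `<=` A' -> fdivides A' th -> fdivides A th.
Proof.
move=> AA' [k [b [tb hb]]]; exists k, b; split=> // i.
by apply/tpP; apply: (eqtp_mono AA'); exact/tpP.
Qed.

Lemma nonforking_base X (A A' : set M) (F : set_system (X -> M)) :
  A `<=` A' -> nonforking A F -> nonforking A' F.
Proof. by move=> AA' nF th /(fdivides_base AA'); exact: nF. Qed.

Definition forking_set X (A : set M) (P : set (X -> M)) : Prop :=
  exists d (delta : 'I_d -> pform M X),
    (forall j, fdivides A (delta j)) /\ forall v, P v -> exists j, psat v (delta j).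

(** [G] together with the complements of all dividing formulas generates a proper filter, because no
    member of [G] is covered by finitely many dividing formulas. Any ultrafilter above it will
    do. *)
Lemma nonforking_extension X (A : set M) (G : set_system (X -> M)) : Filter G ->
  (forall P, G P -> ~ forking_set A P) ->
  exists F, [/\ global_type F, nonforking A F & G `<=` F].
Proof.
move=> fG hG.
pose H : set_system (X -> M) := [set S | exists P d (delta : 'I_d -> pform M X),
  [/\ G P, forall j, fdivides A (delta j) &
    forall v, P v -> (forall j, ~ psat v (delta j)) -> S v]].
have pH : ProperFilter H.
  split; last split.
  - move=> [P [d [delta [GP hd hv]]]]; apply: (hG _ GP); exists d, delta; split=> // v Pv.
    by apply: contrapT => /forallNP n; exact: (hv v).
  - exists setT, 0, (fun i : 'I_0 => False_rect (pform M X) (notF (ltn_ord i))); split=> //.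
      exact: filterT.
    by case.
  - move=> S S' [P [d [delta [GP hd hv]]]] [P' [d' [delta' [GP' hd' hv']]]].
    exists (P `&` P'), (d + d'),
      (fun j => match fintype.split j with inl i => delta i | inr i => delta' i end).
    split; first exact: filterI.
      by move=> j; case: (fintype.split j).
    move=> v [Pv P'v] n; split.
      apply: hv => // j; have := n (unsplit (inl j)); by rewrite unsplitK.
    apply: hv' => // j; have := n (unsplit (inr j)); by rewrite unsplitK.
  - move=> S S' SS' [P [d [delta [GP hd hv]]]]; exists P, d, delta; split=> // v Pv n.
    exact/SS'/hv.
have [F [uF HF]] := ultraFilterLemma pH; exists F; split.
- split; first exact: ultra_proper.
  by move=> P _; exact: in_ultra_setVsetC.
- move=> th hth Fth.
  have : F (~` (fun v => psat v th)).
    apply: HF; exists setT, 1, (fun=> th); split=> //; first exact: filterT.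
    by move=> v _ /(_ ord0).
  by move=> /(filterI Fth)/filter_ex[v []].
- move=> P GP; apply: HF; exists P, 0, (fun i : 'I_0 => False_rect (pform M X) (notF (ltn_ord i))).
  by split=> // -[].
Qed.

Lemma global_decide X (F : set_system (X -> M)) B P : global_type F ->
  definable B P -> F P \/ F (~` P).
Proof. by case=> _ h dP; apply: h; exact: (def_mono (@subsetT _ B) dP). Qed.

Lemma global_consistent X (F : set_system (X -> M)) P : global_type F ->
  F P -> ~ F (~` P).
Proof. by case=> pF _ FP /(filterI FP)/filter_ex[v []]. Qed.

Lemma nonforking_set X (A : set M) (F : set_system (X -> M)) P :
  global_type F -> nonforking A F -> F P -> ~ forking_set A P.
Proof.
move=> gF nF FP [d [delta [hd h]]]; have pF := gF.1.
have FN : F (fun v => forall j, ~ psat v (delta j)).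
  apply: filter_forall => j.
  have dd : definable setT (fun v => psat v (delta j)) by exact: def_psat.
  by case: (global_decide gF dd) => // /nF; case.
have [v [/h[j pj] nv]] := filter_ex (filterI FP FN); exact: (nv j).
Qed.

Lemma freeP X (a : X -> M) (A B : set M) :
  free a A B <-> forall P, definable (A `|` B) P -> P a -> ~ forking_set A P.
Proof.
split=> [[F [gF nF h]] P dP Pa|h].
  exact: nonforking_set gF nF (h _ dP Pa).
pose G : set_system (X -> M) := [set S | exists P, [/\ definable (A `|` B) P, P a & P `<=` S]].
have [||F [gF nF GF]] := @nonforking_extension X A G.
- split; first by exists setT; split=> //; exact: (@def_const _ _ _ X True).
    move=> S S' [P [dP Pa PS]] [P' [dP' P'a PS']]; exists (P `&` P'); split=> //.
      exact: def_and.
    by move=> v [Pv P'v]; split; [exact: PS|exact: PS'].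
  by move=> S S' SS' [P [dP Pa PS]]; exists P; split=> // v /PS; exact: SS'.
- move=> S [P [dP Pa PS]] [d [delta [hd himp]]]; apply: (h P dP Pa).
  by exists d, delta; split=> // v /PS; exact: himp.
by exists F; split=> // P dP Pa; apply: GF; exists P; split.
Qed.

Lemma indepP X (a : X -> M) (A B : set M) : indep a A B <-> free a A B.
Proof.
rewrite freeP; split=> [ni P dP Pa [d [delta [hd h]]]|h [d [delta [hd [n [th [hth himp]]]]]]].
  apply: ni; exists d, delta; split=> //; have [th ov e] := def_pform dP.
  by exists 1, (fun=> th); split=> [_|v /(_ ord0) /e]; [split=> //; exact/e|exact: h].
apply: (h (fun v => forall i, psat v (th i))); last by exists d, delta.
  by apply: def_forall_ord => i; have [ov _] := hth i; exact: def_psat.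
by move=> i; have [] := hth i.
Qed.

Lemma free_mono X (a : X -> M) (A B B' : set M) : B `<=` B' -> free a A B' -> free a A B.
Proof.
move=> BB' [F [gF nF h]]; exists F; split=> // P dP; apply: h.
by apply: def_mono dP; exact: setUS.
Qed.

Lemma free_comp X Y (f : Y -> X) (a : X -> M) (A B : set M) :
  free a A B -> free (a \o f) A B.
Proof.
move=> [F [gF nF h]]; have pF := gF.1.
exists [set S | F (fun v => S (v \o f))]; split; first split.
- split; last split.
  + by move=> /filter_ex[].
  + exact: filterT.
  + by move=> S S' /= FS FS'; exact: filterI.
  + by move=> S S' SS' /=; apply: filterS => v; exact: SS'.
- by move=> P dP; exact: (global_decide gF (def_comp f dP)).
- move=> th [k [b [tb hb]]] /= Fth.
  pose r z : X + 'I_(parity th) := match z with inl y => inl (f y) | inr i => inr i end.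
  have e v u : sat (copair v u) (rename r (pmat th)) <-> sat (copair (v \o f) u) (pmat th).
    rewrite sat_rename.
    suff -> : copair v u \o r = copair (v \o f) u by [].
    by apply/funext => -[].
  apply: (nF (PForm (rename r (pmat th)) (@ppar _ _ _ th))).
    exists k, b; split=> // s sinj [v hv]; apply: (hb s sinj); exists (v \o f) => j.
    exact/e/(hv j).
  by apply: filterS Fth => v /e.
- by move=> P dP Pa; exact: (h _ (def_comp f dP)).
Qed.

(** Allows infinite parameter tuples as witnesses of dividing: [Q] mentions finitely many
    coordinates, and restricting the [ws i] to them keeps their type over [A] and the
    inconsistency. *)
Lemma fdivides_tuple X W (A : set M) (Q : set (X + W -> M)) (w : W -> M)
    (k : nat) (ws : nat -> W -> M) :
  definable A Q -> (forall i, eqtp A (ws i) w) ->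
  (forall s : 'I_k -> nat, injective s -> ~ exists v, forall j, Q (copair v (ws (s j)))) ->
  exists2 th, fdivides A th & forall v, Q (copair v w) <-> psat v th.
Proof.
move=> [phi hphi] tw hk.
pose r (z : (X + W) + {m | A m}) : X + (W + {m | A m}) := match z with
  inl (inl x) => inl x | inl (inr y) => inr (inl y) | inr b => inr (inr b) end.
have [n [g [psi h]]] := sat_finite M (rename r phi).
have e v u : Q (copair v u) <-> sat (copair v (copair u sval \o g)) psi.
  rewrite -h sat_rename hphi.
  suff -> : copair (copair v u) sval = copair v (copair u sval) \o r by [].
  by apply/funext => -[[]|].
exists (PForm psi (copair w sval \o g)); last by move=> v; exact: (e v w).
exists k, (fun i => copair (ws i) sval \o g); split=> [i|s sinj [v hv]].
  apply/tpP.
  suff h1 : eqtp A (copair (ws i) (@sval _ A)) (copair w (@sval _ A)).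
    exact: (eqtp_comp (f := g) h1).
  apply/eqtp_add; apply: eqtp_mono (tw i).
  by move=> m [//|[[m' Am'] _ <-]].
by apply: (hk s sinj); exists v => j; apply/e; exact: hv.
Qed.

Definition realizes_over X (F : set_system (X -> M)) (B : set M) (a : X -> M) : Prop :=
  forall P, definable B P -> F P -> P a.

Lemma realizes_overP X (F : set_system (X -> M)) (B : set M) (a : X -> M) :
  global_type F -> realizes_over F B a ->
  forall P, definable B P -> (F P <-> P a).
Proof.
move=> gF h P dP; split=> [|Pa]; first exact: h.
by case: (global_decide gF dP) => // /(h _ (def_not dP)).
Qed.

Lemma realizes_over_mono X (F : set_system (X -> M)) (B B' : set M) (a : X -> M) :
  B `<=` B' -> realizes_over F B' a -> realizes_over F B a.
Proof. by move=> BB' h P /(def_mono BB'); exact: h. Qed.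

Lemma realizes_over_free X (F : set_system (X -> M)) (A B : set M) (a : X -> M) :
  global_type F -> nonforking A F -> realizes_over F (A `|` B) a -> free a A B.
Proof.
by move=> gF nF h; exists F; split=> // P dP; exact: (realizes_overP gF h dP).2.
Qed.

Lemma aut_pform X (A : set M) (s : M -> M) (th : pform M X) :
  automorphism s -> (forall m, A m -> s m = m) ->
  exists2 th' : pform M X, fdivides A th -> fdivides A th' &
    forall v, psat (s \o v) th <-> psat v th'.
Proof.
move=> sM fixA; have [t [st ts]] : exists t, cancel s t /\ cancel t s.
  by case: (sM) => -[t st ts] _ _; exists t.
exists (PForm (pmat th) (t \o @ppar _ _ _ th)) => [[k [b [tb hb]]]|v].
  exists k, b; split=> // i; rewrite tb; apply/tpP.
  have := @eqtp_aut _ _ _ A s (t \o @ppar _ _ _ th) sM fixA.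
  have -> : s \o (t \o @ppar _ _ _ th) = @ppar _ _ _ th by apply/funext => j; exact: ts.
  by move=> /eqtp_sym.
rewrite /psat /=.
have -> : copair (s \o v) (@ppar _ _ _ th) = s \o copair v (t \o @ppar _ _ _ th).
  by apply/funext => -[a|j] //=; rewrite ts.
exact: sat_aut.
Qed.

Lemma def_aut X (s : M -> M) (P : set (X -> M)) : automorphism s ->
  definable setT P -> definable setT (fun v => P (s \o v)).
Proof.
move=> sM /def_pform[th _ e].
have [|th' _ e'] := @aut_pform X set0 s th sM; first by [].
by apply: (def_ext _ (@def_psat _ _ setT _ th' _)) => // v; rewrite e e'.
Qed.

Lemma free_realizes X (a : X -> M) (A B : set M) : free a A B ->
  exists F, [/\ global_type F, nonforking A F & realizes_over F (A `|` B) a].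
Proof.
move=> [F [gF nF h]]; exists F; split=> // P dP FP; apply: contrapT => nP.
by have := h _ (def_not dP) nP; exact: (global_consistent gF).
Qed.

(** * Invariance of forking under automorphisms over a small set *)

Section Transport.
Variable K : Type.
Hypothesis hM : monster M K.

(** An automorphism over [A0] conjugates the dividing formulas. The set [A0] may exceed [A] because
    [Q] can have further parameters while forking is still measured over [A]. *)
Lemma forking_set_eqtp X W (A A0 : set M) (Q : set (X + W -> M)) (w w' : W -> M) :
  small K [set: W] -> small K A0 -> A `<=` A0 -> definable A0 Q -> eqtp A0 w w' ->
  forking_set A (fun v => Q (copair v w)) -> forking_set A (fun v => Q (copair v w')).
Proof.
move=> sW sA AA0 dQ /eqtp_sym/(homogeneity hM sW sA)[s [sM fixA ew]] [d [delta [hd h]]].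
have fixA' m : A m -> s m = m by move=> /AA0; exact: fixA.
have [delta' h1 h2] : exists2 delta' : 'I_d -> pform M X,
    forall j, fdivides A (delta' j) & forall j v, psat (s \o v) (delta j) <-> psat v (delta' j).
  have [|f hf] := @choice _ _ (fun j th =>
      fdivides A th /\ forall v, psat (s \o v) (delta j) <-> psat v th).
    move=> j; have [th' h1 h2] := aut_pform (delta j) sM fixA'.
    by exists th'; split; [exact: h1|].
  by exists f => j; have [] := hf j.
exists d, delta'; split=> // v Qv.
have [|j] := h (s \o v); last by move=> /h2; exists j.
rewrite -ew.
have -> : copair (s \o v) (s \o w') = s \o copair v w' by apply/funext => -[].
by apply: (eqtp_aut sM fixA).
Qed.

Lemma free_eqtp X W (A : set M) (a a' : X -> M) (w w' : W -> M) :
  small K [set: W] -> small K A -> eqtp A (copair a w) (copair a' w') ->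
  free a A (range w) -> free a' A (range w').
Proof.
move=> sW sA e /freeP h; apply/freeP => P /def_split[Q dQ eQ] /eQ Qa fP.
have ew : eqtp A w' w by exact: (eqtp_comp (f := inr) (eqtp_sym e)).
have fQ : forking_set A (fun v => Q (copair v w')).
  by have [d [delta [hd hv]]] := fP; exists d, delta; split=> // v /eQ; exact: hv.
apply: (h (fun v => Q (copair v w))); last 1 first.
- exact: (forking_set_eqtp sW sA (@subset_refl _ A) dQ ew fQ).
- by apply: (def_fiber _ _ dQ) => [|x]; [exact: subsetUl|right; exists x].
- exact: (eqtp_sym e dQ Qa).
Qed.

End Transport.
End Forking.

(** * Indiscernible sequences under NIP *)

Section Sequences.
Variables (L : language) (M : structure L).

Definition flat I X (x : I -> X -> M) (z : I * X) : M := x z.1 z.2.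

Definition rows X (x : nat -> X -> M) n (z : 'I_n.+1 * X) : M := x z.1 z.2.

(* Indiscernible sequences and sets, phrased with infinite subsequences: since
   formulas have finite support this amounts to the usual finitary notion, and
   it composes without reindexing finite tuples. *)
Definition iseq X (A : set M) (x : nat -> X -> M) : Prop :=
  forall f : nat -> nat, {homo f : i j / (i < j)%N} -> eqtp A (flat x) (flat (x \o f)).

Definition iset X (A : set M) (x : nat -> X -> M) : Prop :=
  forall f : nat -> nat, injective f -> eqtp A (flat x) (flat (x \o f)).

Lemma homo_inj (f : nat -> nat) : {homo f : i j / (i < j)%N} -> injective f.
Proof.
by move=> hf i j e; case: (ltngtP i j) => // /hf; rewrite e ltnn.
Qed.

Lemma iset_iseq X (A : set M) (x : nat -> X -> M) : iset A x -> iseq A x.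
Proof. by move=> h f /homo_inj; exact: h. Qed.

Lemma iset_comp X (A : set M) (x : nat -> X -> M) f : injective f -> iset A x -> iset A (x \o f).
Proof.
move=> fi h g gi; apply: eqtp_trans (eqtp_sym (h f fi)) _.
exact: (h (f \o g) (inj_comp fi gi)).
Qed.

Lemma iset_eqtp X (A : set M) (x y : nat -> X -> M) :
  eqtp A (flat x) (flat y) -> iset A x -> iset A y.
Proof.
move=> e h f fi; apply: eqtp_trans (eqtp_sym e) _; apply: eqtp_trans (h f fi) _.
exact: (eqtp_comp (f := fun z => (f z.1, z.2)) e).
Qed.

Lemma iset_mono X (A A' : set M) (x : nat -> X -> M) : A `<=` A' -> iset A' x -> iset A x.
Proof. by move=> AA' h f fi; exact: eqtp_mono (h f fi). Qed.

Lemma iseq_mono X (A A' : set M) (x : nat -> X -> M) : A `<=` A' -> iseq A' x -> iseq A x.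
Proof. by move=> AA' h f fi; exact: eqtp_mono (h f fi). Qed.

Lemma iseq_proj X Y (p : Y -> X) (A : set M) (x : nat -> X -> M) :
  iseq A x -> iseq A (fun i => x i \o p).
Proof. by move=> h f fi; exact: (eqtp_comp (f := fun z => (z.1, p z.2)) (h f fi)). Qed.

Lemma def_rows X Z (A : set M) (P : set (nat * X + Z -> M)) : definable A P ->
  exists n, exists2 P' : set ('I_n.+1 * X + Z -> M), definable A P' &
    forall x v, P (copair (flat x) v) <-> P' (copair (rows x (n := n)) v).
Proof.
move=> dP; have [s hs] := def_support dP.
have [n hn] : exists n, forall i x, In (inl (i, x)) s -> i <= n.
  elim: (s) => [|[[j y]|z] l [n IH]]; first by exists 0.
    exists (maxn j n) => i x [[-> _]|/IH]; first exact: leq_maxl.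
    by move=> h; exact: leq_trans h (leq_maxr _ _).
  by exists n => i x [//|/IH].
pose r (z : nat * X + Z) : 'I_n.+1 * X + Z :=
  match z with inl y => inl (inord y.1, y.2) | inr t => inr t end.
exists n, (fun u => P (u \o r)); first exact: def_comp.
move=> x v.
have e z : In z s -> copair (flat x) v z = (copair (rows x (n := n)) v \o r) z.
  by case: z => [[i y] /hn le|t] //=; rewrite /flat /rows /= inordK.
by split; apply: hs => z zs; rewrite e.
Qed.

Lemma rows_eqtp X Z (A : set M) (x y : nat -> X -> M) (c : Z -> M) :
  (forall n (P : set ('I_n.+1 * X + Z -> M)), definable A P ->
     P (copair (rows x (n := n)) c) -> P (copair (rows y (n := n)) c)) ->
  eqtp (A `|` range c) (flat x) (flat y).
Proof.
move=> h; apply/eqtp_add => P /def_rows[n [P' dP' e]].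
by rewrite !e; exact: h.
Qed.

Lemma eqtp_row X Z (A : set M) (Q : set (Z + X -> M)) (x y : nat -> X -> M) (c d : Z -> M) i :
  definable A Q -> eqtp A (copair (flat x) c) (copair (flat y) d) ->
  Q (copair c (x i)) -> Q (copair d (y i)).
Proof.
pose r (z : Z + X) : nat * X + Z := match z with inl t => inr t | inr a => inl (i, a) end.
move=> dQ /(_ _ (def_comp r dQ)).
have e x' c' : copair (flat x') c' \o r = copair c' (x' i) by apply/funext => -[].
by rewrite !e.
Qed.

(** * Nonforking types along indiscernible sequences *)

Section NIP.
Variable K : Type.
Hypothesis hM : monster M K.
Hypothesis hNIP : forall n m (phi : form L ('I_n + 'I_m)), ~ has_IP M phi.

Let hnat : small K [set: nat] := monster_nat hM.
Let hSL : strong_limit K. Proof. by case: hM. Qed.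

(** Compactness turns finite patterns of every length into [has_IP]. The latter wants finite tuples
    on both sides, so [sat_finite] is applied once to [z] and, after exchanging sides, once to [x i]
    together with the parameters from [A]. *)
Lemma nip_pattern X Z (A : set M) (Q : set (Z + X -> M)) (x : nat -> X -> M) :
  definable A Q ->
  ~ forall m (S : set nat), exists z, forall i, i < m -> (Q (copair z (x i)) <-> S i).
Proof.
move=> [phi hphi] hpat.
pose r (z : (Z + X) + {m | A m}) : (X + {m | A m}) + Z := match z with
  inl (inl t) => inr t | inl (inr a) => inl (inl a) | inr b => inl (inr b) end.
have [m [g [psi hpsi]]] := sat_finite M (rename r phi).
pose sw (z : (X + {m | A m}) + 'I_m) := match z with inl a => inr a | inr b => inl b end.
have [n [h [chi hchi]]] := sat_finite M (rename sw psi).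
pose sw' (z : 'I_m + 'I_n) := match z with inl a => inr a | inr b => inl b end.
pose a i := copair (x i) (@sval _ A) \o h.
have e z i : Q (copair z (x i)) <-> sat (copair (a i) (z \o g)) (rename sw' chi).
  rewrite sat_rename hphi.
  have -> : copair (a i) (z \o g) \o sw' = copair (z \o g) (a i) by apply/funext => -[].
  rewrite -hchi sat_rename.
  have -> : copair (z \o g) (copair (x i) sval) \o sw = copair (copair (x i) sval) (z \o g).
    by apply/funext => -[].
  rewrite -hpsi sat_rename.
  suff -> : copair (copair z (x i)) sval = copair (copair (x i) sval) z \o r by [].
  by apply/funext => -[[]|].
have hS (S : set nat) : exists b, forall i, sat (copair (a i) b) (rename sw' chi) <-> S i.
  pose F : set_system ('I_m -> M) := [set T | exists N, forall b,
    (forall i, i < N -> (sat (copair (a i) b) (rename sw' chi) <-> S i)) -> T b].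
  have pF : ProperFilter F.
    split; last split.
    - by case=> N h0; have [z hz] := hpat N S; apply: (h0 (z \o g)) => i /hz; rewrite e.
    - by exists 0.
    - move=> T T' [N hT] [N' hT']; exists (maxn N N') => b hb.
      by split; [apply: hT|apply: hT'] => i iN; apply: hb; rewrite leq_max iN ?orbT.
    - by move=> T T' TT' [N hT]; exists N => b /hT; exact: TT'.
  pose B := range (flat a).
  have sB : small K B by apply/small_image/small_prod => //; exact: small_ord.
  have [b hb] := filter_realized hM (@small_ord _ hnat m) sB pF.
  exists b => i; apply: (hb (fun b => sat (copair (a i) b) (rename sw' chi) <-> S i)).
    have dchi : definable B (fun b => sat (copair (a i) b) (rename sw' chi)).
      have Bi j : B (a i j) by exists (i, j).
      have d0 : definable set0 (fun u : 'I_n + 'I_m -> M => sat u (rename sw' chi)).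
        by exists (rename inl (rename sw' chi)) => v; rewrite (sat_rename _ inl).
      apply: (def_ext _ (def_plug (fun z : 'I_n + 'I_m => match z with
        inl j => inr (exist _ (a i j) (Bi j)) | inr j => inl j end) (@sub0set _ B) d0)) => v.
      set w := (X in sat X _); suff -> : w = copair (a i) v by [].
      by apply/funext => -[].
    have [Si|nSi] := pselect (S i); first by apply: (def_ext _ dchi) => v; tauto.
    by apply: (def_ext _ (def_not dchi)) => v; rewrite /setC /=; tauto.
  by exists i.+1 => b' /(_ i (ltnSn i)).
have [b hb] := choice hS.
by apply: (hNIP (phi := rename sw' chi)); exists a, b => i S; exact: hb.
Qed.

(** Bounded alternation: if one [z] told apart the terms of many consecutive pairs, choosing from
    each pair the term prescribed by [S] would, by indiscernibility, produce every pattern on an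
    initial segment of [x]. *)
Lemma iseq_alternation X Z (A : set M) (Q : set (Z + X -> M)) (x : nat -> X -> M) :
  small K A -> small K [set: X] -> definable A Q -> iseq A x ->
  exists k, forall s : 'I_k -> nat, injective s -> ~ exists z, forall j,
    Q (copair z (x (s j).*2)) /\ ~ Q (copair z (x (s j).*2.+1)).
Proof.
move=> sA sX dQ ix; apply: contrapT => /forallNP nk.
apply: (@nip_pattern _ _ _ _ x dQ) => m S.
have /existsNP[s /not_implyP[sinj /contrapT[z hz]]] := nk m.
pose u := sort leq (codom s).
have su : size u = m by rewrite size_sort size_codom card_ord.
have ult : sorted ltn u.
  rewrite ltn_sorted_uniq_leq sort_uniq sort_sorted ?andbT; last exact: leq_total.
  exact/injectiveP.
pose t i := nth 0 u i.
have tlt i j : i < j -> j < m -> t i < t j.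
  move=> ij jm; apply: (sorted_ltn_nth ltn_trans) => //; rewrite inE su //.
  exact: ltn_trans jm.
have tmem i : i < m -> exists j, t i = s j.
  move=> im; have : t i \in u by rewrite mem_nth // su.
  by rewrite mem_sort => /codomP.
pose bm := \max_(j < m) s j.
have tle i : i < m -> t i <= bm.
  by move=> /tmem[j ->]; exact: (leq_bigmax j).
(* The even term of a pair when [S i], the odd one otherwise. The chosen indices are at most
   [bm.*2.+1], so the tail keeps [f] increasing. *)
pose f i := if i < m then (t i).*2 + ~~ `[< S i >] else bm.*2 + i.+2.
have hf : {homo f : i j / (i < j)%N}.
  move=> i j ij; rewrite /f; case: (ltnP i m) => im; case: (ltnP j m) => jm.
  - by have := tlt _ _ ij jm; case: (~~ _); case: (~~ _) => /=; lia.
  - by have := tle _ im; case: (~~ _) => /=; lia.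
  - by lia.
  - by lia.
have sXn : small K [set: nat * X] by exact: small_prod.
have [z' hz'] := eqtp_extend hM z sXn sA (eqtp_sym (ix f hf)).
exists z' => i im.
have -> : Q (copair z' (x i)) <-> Q (copair z ((x \o f) i)).
  split; apply: (@eqtp_row _ _ _ _ _ _ _ _ i dQ) => //.
  exact: eqtp_sym.
have [j tj] := tmem _ im; have [h1 h2] := hz j.
rewrite /= /f im tj; case: (asboolP (S i)) => Si /=; first by rewrite addn0.
by rewrite addn1.
Qed.

(** If [F] separated [x 0] from [x 1], the formula saying so would divide over [A] along the
    disjoint pairs [x i.*2], [x i.*2.+1], by bounded alternation. *)
Lemma nonforking_iseq2 X Z (A : set M) (F : set_system (Z -> M))
    (Q : set (Z + X -> M)) (x : nat -> X -> M) :
  small K A -> small K [set: X] -> global_type F -> nonforking A F ->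
  definable A Q -> iseq A x ->
  F (fun v => Q (copair v (x 0))) <-> F (fun v => Q (copair v (x 1))).
Proof.
move=> sA sX gF nF; move: Q.
suff imp Q : definable A Q -> iseq A x ->
    F (fun v => Q (copair v (x 0))) -> F (fun v => Q (copair v (x 1))).
  move=> Q dQ ix; split; first exact: imp.
  have d0 : definable setT (fun v : Z -> M => Q (copair v (x 0))).
    by apply: def_fiber dQ.
  case: (global_decide gF d0) => // n0.
  have := imp _ (def_not dQ) ix n0 => n1 F1.
  by case: (global_consistent gF F1).
move=> dQ ix F0.
have d1 : definable setT (fun v : Z -> M => Q (copair v (x 1))) by apply: def_fiber dQ.
case: (global_decide gF d1) => // n1; exfalso.
have [k hk] := iseq_alternation sA sX dQ ix.
pose g0 (z : Z + X) : Z + (X + X) := match z with inl t => inl t | inr a => inr (inl a) end.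
pose g1 (z : Z + X) : Z + (X + X) := match z with inl t => inl t | inr a => inr (inr a) end.
have dd := def_and (def_comp g0 dQ) (def_not (def_comp g1 dQ)).
have e0 v (a b : X -> M) : copair v (copair a b) \o g0 = copair v a by apply/funext => -[].
have e1 v (a b : X -> M) : copair v (copair a b) \o g1 = copair v b by apply/funext => -[].
have [|s sinj [v hv]|th dth eth] :=
    fdivides_tuple (w := copair (x 0) (x 1)) (k := k)
      (ws := fun i => copair (x i.*2) (x i.*2.+1)) dd.
- move=> i; apply: eqtp_sym.
  pose g (z : X + X) : nat * X := match z with inl a => (0, a) | inr a => (1, a) end.
  have hf : {homo (fun j => i.*2 + j) : a b / (a < b)%N} by move=> a b; lia.
  have := eqtp_comp (f := g) (ix _ hf).
  have -> : flat x \o g = copair (x 0) (x 1) by apply/funext => -[].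
  suff -> : flat (x \o [eta addn i.*2]) \o g = copair (x i.*2) (x i.*2.+1) by [].
  by apply/funext => -[a|a]; rewrite /flat /= ?addn0 ?addn1.
- apply: (hk s sinj); exists v => j; have [] := hv j.
  by rewrite /setC /= e0 e1.
- apply: (nF th dth); have pF := gF.1.
  apply: filterS (filterI F0 n1) => v [h0 h1]; apply/eth.
  by rewrite /setC /setI /= e0 e1.
Qed.

Section Block.
Variables (X Z : Type) (A : set M) (F : set_system (Z -> M)) (x : nat -> X -> M).
Hypotheses (sA : small K A) (sX : small K [set: X]).
Hypotheses (gF : global_type F) (nF : nonforking A F) (ix : iseq A x).

(** A block and a second one far beyond it are the first two terms of an indiscernible sequence [y]
    of blocks, to which [nonforking_iseq2] applies. Two arbitrary increasing blocks are then
    compared through a third one beyond both. *)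
Let nonforking_far n (P : set ('I_n.+1 * X + Z -> M)) f N :
  definable A P -> {homo f : i j / (i < j)%N} -> f n < N ->
  F (fun v => P (copair (rows (x \o f) (n := n)) v)) <->
  F (fun v => P (copair (rows (x \o [eta addn (N + n.+1)]) (n := n)) v)).
Proof.
move=> dP hf fN.
pose h i j := if i == 0 then f j else N + i * n.+1 + j.
have hlt a b a' b' : b <= n -> b' <= n -> a < a' \/ (a = a' /\ b < b') -> h a b < h a' b'.
  move=> bn b'n; rewrite /h.
  have fb : f b <= f n by rewrite leq_eqVlt in bn; case/orP: bn => [/eqP ->//|/hf /ltnW].
  case: a => [|a]; case: a' => [|a'] //=.
  - by move=> [//|[_ /hf]].
  - by move=> _; nia.
  - by move=> [//|[]].
  - by move=> [aa'|[[->]]]; nia.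
pose y i (z : 'I_n.+1 * X) := x (h i z.1) z.2.
have iy : iseq A y.
  pose G (p : nat -> nat) k := h (p (k %/ n.+1)) (k %% n.+1).
  have hG p : {homo p : i j / (i < j)%N} -> {homo G p : i j / (i < j)%N}.
    have mn k : k %% n.+1 <= n by rewrite -ltnS ltn_pmod.
    move=> hp k l kl; rewrite /G; apply: (hlt _ _ _ _ (mn k) (mn l)).
    have : k %/ n.+1 <= l %/ n.+1 by apply: leq_div2r; exact: ltnW.
    rewrite leq_eqVlt => /orP[/eqP e|hl]; last by left; exact: hp.
    right.
    rewrite e; split=> //; move: kl.
    by rewrite {1}(divn_eq k n.+1) {1}(divn_eq l n.+1) e ltn_add2l.
  pose r (z : nat * ('I_n.+1 * X)) := (z.1 * n.+1 + z.2.1, z.2.2).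
  have e p : flat (y \o p) = flat (x \o G p) \o r.
    apply/funext => -[i [j a]]; rewrite /flat /= /y /= /G.
    by rewrite divnMDl // modnMDl modn_small ?divn_small ?addn0.
  move=> p hp; rewrite (e p) (e id : flat y = _); apply: eqtp_comp.
  have hid : {homo id : i j / (i < j)%N} by [].
  exact: eqtp_trans (eqtp_sym (ix (hG _ hid))) (ix (hG _ hp)).
pose sw (z : 'I_n.+1 * X + Z) : Z + 'I_n.+1 * X :=
  match z with inl a => inr a | inr b => inl b end.
have e v w : copair v w \o sw = copair w v by apply/funext => -[].
have sY : small K [set: 'I_n.+1 * X] by apply: small_prod => //; exact: small_ord.
have := nonforking_iseq2 sA sY gF nF (def_comp sw dP) iy.
have -> : (fun v => P (copair v (y 0) \o sw)) = fun v => P (copair (rows (x \o f) (n:=n)) v).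
  by apply/funext => v; rewrite e.
suff -> : (fun v => P (copair v (y 1) \o sw)) =
    fun v => P (copair (rows (x \o [eta addn (N + n.+1)]) (n := n)) v) by [].
apply/funext => v; rewrite e; do 2 f_equal.
by apply/funext => -[j a]; rewrite /y /rows /= /h /= mul1n.
Qed.

Lemma nonforking_rows n (P : set ('I_n.+1 * X + Z -> M)) f :
  definable A P -> {homo f : i j / (i < j)%N} ->
  F (fun v => P (copair (rows (x \o f) (n := n)) v)) <->
  F (fun v => P (copair (rows x (n := n)) v)).
Proof.
move=> dP hf; have hid : {homo id : i j / (i < j)%N} by [].
have fn : n <= f n by elim: (n) => // k /leq_ltn_trans; apply; exact: hf.
rewrite (nonforking_far dP hf (ltnSn _)).
by rewrite -(nonforking_far dP hid (N := (f n).+1)).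
Qed.

End Block.

Lemma rows_realized X Z (A : set M) (F : set_system (Z -> M)) (x : nat -> X -> M)
    n (P : set ('I_n.+1 * X + Z -> M)) f c :
  global_type F -> definable A P -> realizes_over F (A `|` range (flat x)) c ->
  F (fun v => P (copair (rows (x \o f) (n := n)) v)) <-> P (copair (rows (x \o f) (n := n)) c).
Proof.
move=> gF dP rc; apply: (realizes_overP gF rc (P := fun v => P (copair _ v))).
pose sw (z : 'I_n.+1 * X + Z) : Z + 'I_n.+1 * X :=
  match z with inl a => inr a | inr b => inl b end.
have hr z : (A `|` range (flat x)) (rows (x \o f) (n := n) z).
  by right; exists (f z.1, z.2).
apply: (def_ext _ (def_fiber (@subsetUl _ A _) hr (def_comp sw dP))) => v.
suff -> : copair v (rows (x \o f) (n := n)) \o sw = copair (rows (x \o f) (n := n)) v by [].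
by apply/funext => -[].
Qed.

Lemma nonforking_iseq X Z (A : set M) (F : set_system (Z -> M)) (x : nat -> X -> M) c :
  small K A -> small K [set: X] -> global_type F -> nonforking A F -> iseq A x ->
  realizes_over F (A `|` range (flat x)) c -> iseq (A `|` range c) x.
Proof.
move=> sA sX gF nF ix rc f hf; apply: rows_eqtp => n P dP.
have hid : {homo id : i j / (i < j)%N} by [].
rewrite -(rows_realized f gF dP rc) -(rows_realized id gF dP rc).
by rewrite !(nonforking_rows sA sX gF nF ix dP).
Qed.

Lemma nonforking_iset X Z (A : set M) (F : set_system (Z -> M)) (x : nat -> X -> M) c :
  small K A -> small K [set: X] -> global_type F -> nonforking A F -> iset A x ->
  realizes_over F (A `|` range (flat x)) c -> iset (A `|` range c) x.
Proof.
move=> sA sX gF nF ix rc f fi; apply: rows_eqtp => n P dP.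
rewrite -(rows_realized f gF dP rc) -(rows_realized id gF dP rc).
have hid : {homo id : i j / (i < j)%N} by [].
rewrite (nonforking_rows sA sX gF nF (iset_iseq ix) dP hid) => Fx.
pose N := (\max_(i < n.+1) f i).+1.
have hN i : i <= n -> f i < N.
  by move=> le; rewrite ltnS; exact: (leq_bigmax (Ordinal (le : i < n.+1))).
(* [f'] keeps the block of [f] but ends in a tail of [x] itself. Within [x \o f'] the block is
   exchanged for a block of this tail, and within [x] that one for the initial block. *)
pose f' k := if k <= n then f k else N + k.
have f'i : injective f'.
  move=> i j; rewrite /f'; case: (leqP i n) => [/hN hi|hi]; case: (leqP j n) => [/hN hj|hj].
  - exact: fi.
  - by lia.
  - by lia.
  - by lia.
have e1 : rows (x \o f) (n := n) = rows (x \o f') (n := n).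
  by apply/funext => -[[i lti] a]; rewrite /rows /= /f' -ltnS lti.
have hs m : {homo [eta addn m] : i j / (i < j)%N} by move=> i j; rewrite ltn_add2l.
rewrite e1 -(nonforking_rows sA sX gF nF (iset_iseq (iset_comp f'i ix)) dP (hs n.+1)).
have -> : rows ((x \o f') \o [eta addn n.+1]) (n := n) =
    rows (x \o [eta addn (N + n.+1)]) (n := n).
  apply/funext => -[i a]; rewrite /rows /= /f'.
  by rewrite ifF ?addnA //; lia.
by rewrite (nonforking_rows sA sX gF nF (iset_iseq ix) dP (hs _)).
Qed.

End NIP.
End Sequences.

(** * Averages of indiscernible sets *)

Lemma dependent_choice_history T (R : seq T -> T -> Prop) :
  (forall l, exists x, R l x) -> exists f : nat -> T, forall n, R (mkseq f n) (f n).
Proof.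
move=> /choice[ch hch]; pose l n := iter n (fun l => rcons l (ch l)) [::].
exists (fun n => ch (l n)) => n.
suff -> : mkseq (fun n => ch (l n)) n = l n by exact: hch.
by elim: n => // n IH; rewrite mkseqS IH.
Qed.

Lemma In_mkseq T (f : nat -> T) n x : In x (mkseq f n) <-> exists2 j, j < n & f j = x.
Proof.
elim: n => [|n IH]; first by split=> // -[].
rewrite mkseqS -cats1 in_app_iff IH /=; split=> [[[j jn <-]|[<-|//]]|[j]].
- by exists j => //; exact: ltnW.
- by exists n.
- rewrite ltnS leq_eqVlt => /orP[/eqP ->|jn] e; first by right; left.
  by left; exists j.
Qed.

Lemma infinite_enum (P : set nat) : (forall N, exists2 k, N <= k & P k) ->
  exists2 g : nat -> nat, {homo g : i j / (i < j)%N} & forall i, P (g i).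
Proof.
move=> h; have hc N : exists k, N <= k /\ P k by have [k] := h N; exists k.
have [s hs] := choice hc.
pose g := fix g n := if n is m.+1 then s (g m).+1 else s 0.
exists g; last by case=> [|i] /=; [have [] := hs 0|have [] := hs (g i).+1].
apply: homo_ltn => [|i]; first exact: ltn_trans.
by have [] := hs (g i).+1.
Qed.

Section Average.
Variables (L : language) (M : structure L).

Definition average X (x : nat -> X -> M) : set_system (X -> M) :=
  [set P | exists N, forall k, N <= k -> P (x k)].

(* [prepends c m x] is the sequence c_(m-1), ..., c_0, x_0, x_1, ... *)
Definition prepend X (c : X -> M) (x : nat -> X -> M) (i : nat) : X -> M :=
  if i is j.+1 then x j else c.

Fixpoint prepends X (c : nat -> X -> M) m (x : nat -> X -> M) : nat -> X -> M :=
  if m is m'.+1 then prepend (c m') (prepends c m' x) else x.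

Definition history X (c : nat -> X -> M) m : set M :=
  [set y | exists j a, j < m /\ y = c j a].

Lemma average_proper X (x : nat -> X -> M) : ProperFilter (average x).
Proof.
split; last split.
- by case=> N /(_ N (leqnn N)).
- by exists 0.
- move=> P Q [N hN] [N' hN']; exists (maxn N N') => k; rewrite geq_max => /andP[h h'].
  by split; [exact: hN|exact: hN'].
- by move=> P Q PQ [N hN]; exists N => k /hN; exact: PQ.
Qed.

Lemma average_prepend X (c : X -> M) (x : nat -> X -> M) P :
  average (prepend c x) P <-> average x P.
Proof.
split=> -[N h].
  by exists N => k Nk; exact: (h k.+1 (leqW Nk)).
by exists N.+1 => -[|k] //= Nk; exact: h.
Qed.

Lemma average_prepends X (c : nat -> X -> M) m (x : nat -> X -> M) P :
  average (prepends c m x) P <-> average x P.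
Proof. by elim: m => //= m IH; rewrite average_prepend. Qed.

Lemma prepends_lt X (c : nat -> X -> M) m (x : nat -> X -> M) k :
  k < m -> prepends c m x k = c (m - k.+1).
Proof.
elim: m k => //= m IH [|k] km /=; first by rewrite subn1.
by rewrite IH.
Qed.

Lemma prepends_ge X (c : nat -> X -> M) m (x : nat -> X -> M) k : prepends c m x (m + k) = x k.
Proof. by elim: m => //= m; rewrite addSn. Qed.

Lemma eqtp_plug X Y (B : set M) (a b : X -> M) (h : Y -> X + {m | B m}) :
  eqtp B a b -> eqtp B (copair a sval \o h) (copair b sval \o h).
Proof. by move=> e P dP; exact: (e _ (def_plug h (@subset_refl _ B) dP)). Qed.

Lemma eqtp_prepends X (A : set M) (c : nat -> X -> M) m (x y : nat -> X -> M) :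
  eqtp (A `|` history c m) (flat x) (flat y) ->
  eqtp (A `|` history c m) (flat (prepends c m x)) (flat (prepends c m y)).
Proof.
move=> e.
have hh (z : nat * X) : exists w : nat * X + {b | (A `|` history c m) b},
    forall x, copair (flat x) sval w = flat (prepends c m x) z.
  case: z => k a; case: (ltnP k m) => km.
    have hk : (A `|` history c m) (c (m - k.+1) a).
      by right; exists (m - k.+1), a; split=> //; lia.
    by exists (inr (exist _ _ hk)) => x'; rewrite /flat /= prepends_lt.
  exists (inl (k - m, a)) => x'; rewrite /flat /=.
  by have := prepends_ge c m x' (k - m); rewrite subnKC // => ->.
have [h hP] := choice hh; have := eqtp_plug (h := h) e.
have E x' : copair (flat x') sval \o h = flat (prepends c m x').
  by apply/funext => z; exact: hP.
by rewrite !E.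
Qed.

Lemma eqtp_prepend X (A : set M) (c : X -> M) (x y : nat -> X -> M) :
  eqtp (A `|` range c) (flat x) (flat y) -> eqtp A (flat (prepend c x)) (flat (prepend c y)).
Proof.
move=> /eqtp_add.
pose r (z : nat * X) : nat * X + X := if z.1 is k.+1 then inl (k, z.2) else inr z.2.
have E x' : flat (prepend c x') = copair (flat x') c \o r by apply/funext => -[[|k] a].
by move=> /(eqtp_comp (f := r)); rewrite !E.
Qed.

Section NIP.
Variable K : Type.
Hypothesis hM : monster M K.
Hypothesis hNIP : forall n m (phi : form L ('I_n + 'I_m)), ~ has_IP M phi.

Let hnat : small K [set: nat] := monster_nat hM.
Let hSL : strong_limit K. Proof. by case: hM. Qed.

Lemma definable_small X (P : set (X -> M)) : definable setT P ->
  exists2 E, small K E & definable E P.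
Proof.
move=> /def_pform[th _ e]; exists (range (@ppar _ _ _ th)).
  exact/small_image/small_ord.
by apply: (def_ext _ (@def_psat _ _ _ _ th _)) => [v|i]; [rewrite e|exists i].
Qed.

Lemma small_history X (c : nat -> X -> M) m : small K [set: X] -> small K (history c m).
Proof.
move=> sX; apply: (small_sub (B := range (flat c))).
  by move=> _ [j [a [_ ->]]]; exists (j, a).
exact/small_image/small_prod.
Qed.

Lemma small_flat X (x : nat -> X -> M) : small K [set: X] -> small K (range (flat x)).
Proof. by move=> sX; exact/small_image/small_prod. Qed.

Lemma chain_realized X (B : set M) (F : set_system (X -> M)) :
  small K B -> small K [set: X] -> global_type F ->
  exists c : nat -> X -> M, forall m, realizes_over F (B `|` history c m) (c m).
Proof.
move=> sB sX [pF _].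
have [|c hc] := @dependent_choice_history (X -> M) (fun l c => realizes_over F
    (B `|` [set y | exists d a, In d l /\ y = d a]) c).
  move=> l; apply: (filter_realized hM sX _ pF); apply: small_setU => //.
  apply: (small_sub (B := \bigcup_(d in [set d | In d l]) range d)).
    by move=> _ [d [a [dl ->]]]; exists d.
  elim: l => [|d l IH].
    by apply: (small_rel (R := fun _ _ => True) hnat) => [y [d []]|y y' n [d []]].
  apply: (small_sub (B := range d `|` \bigcup_(d in [set d | In d l]) range d)).
    by move=> y [e [<-|el] ry]; [left|right; exists e].
  by apply: small_setU => //; exact: small_image.
exists c => m; apply: realizes_over_mono (hc m).
apply: setUS => _ [j [a [jm ->]]]; exists (c j), a; split=> //.
by apply/In_mkseq; exists j.
Qed.

Section Iset.
Variables (X : Type) (A : set M) (x : nat -> X -> M).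
Hypotheses (sA : small K A) (sX : small K [set: X]) (ix : iset A x).

Let sXn : small K [set: nat * X]. Proof. exact: small_prod. Qed.

(** Given a cut of length [m], send the members of [S] to the part where [Q] holds and the others to
    the part where it fails: total indiscernibility moves the pattern back onto [x], against NIP.
    The bound [m] is uniform in [y] and [z]. *)
Lemma iset_cut Z (Q : set (Z + X -> M)) : definable A Q ->
  exists m, forall y z, eqtp A (flat x) (flat y) ->
    ~ ((forall k, k < m -> Q (copair z (y k))) /\
       (forall k, m <= k < m.*2 -> ~ Q (copair z (y k)))).
Proof.
move=> dQ; apply: contrapT => /forallNP nm.
apply: (nip_pattern hM hNIP dQ (x := x)) => m S.
have /existsNP[y /existsNP[z /not_implyP[e /contrapT[h1 h2]]]] := nm m.
pose f i := if i < m then (if `[< S i >] then i else m + i) else m.*2 + i.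
have fi : injective f.
  move=> i j; rewrite /f; case: (asbool (S i)); case: (asbool (S j));
    case: (ltnP i m) => im; case: (ltnP j m) => jm; lia.
have e' : eqtp A (flat (y \o f)) (flat x).
  exact: eqtp_sym (eqtp_trans e (iset_eqtp e ix fi)).
have [z' hz'] := eqtp_extend hM z sXn sA e'.
exists z' => i im.
have -> : Q (copair z' (x i)) <-> Q (copair z ((y \o f) i)).
  split; apply: (@eqtp_row _ _ _ _ _ _ _ _ _ _ i dQ) => //.
  exact: eqtp_sym.
rewrite /= /f im; case: (asboolP (S i)) => Si; split=> // h; first exact: h1.
by case: (h2 (m + i)) => //; lia.
Qed.

Lemma iset_cut_set (P : set (X -> M)) : definable setT P ->
  exists m, forall y, eqtp A (flat x) (flat y) ->
    ~ ((forall k, k < m -> P (y k)) /\ (forall k, m <= k < m.*2 -> ~ P (y k))).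
Proof.
move=> /def_pform[th _ e].
pose sw (z : X + 'I_(parity th)) := match z with inl a => inr a | inr b => inl b end.
have dQ : definable A (fun u => sat u (rename sw (pmat th))).
  by exists (rename inl (rename sw (pmat th))) => v; rewrite (sat_rename _ inl).
have [m hm] := iset_cut dQ; exists m => y ey [h1 h2].
have E k : P (y k) <-> sat (copair (@ppar _ _ _ th) (y k)) (rename sw (pmat th)).
  rewrite e sat_rename /psat.
  suff -> : copair (@ppar _ _ _ th) (y k) \o sw = copair (y k) (@ppar _ _ _ th) by [].
  by apply/funext => -[].
by apply: (hm y (@ppar _ _ _ th) ey); split=> k /[dup] km; [move=> /h1|move=> /h2]; rewrite E.
Qed.

Lemma average_global : global_type (average x).
Proof.
split=> [|P dP]; first exact: average_proper.
apply: contrapT => /not_orP[n1 n2].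
have [|g1 hg1 g1P] := @infinite_enum (fun k => ~ P (x k)).
  move=> N; apply: contrapT => h; apply: n1; exists N => k Nk.
  by apply: contrapT => nP; apply: h; exists k.
have [|g2 hg2 g2P] := @infinite_enum (fun k => P (x k)).
  move=> N; apply: contrapT => h; apply: n2; exists N => k Nk Pk.
  by apply: h; exists k.
have [m hm] := iset_cut_set dP.
(* If [P] and its complement both recurred forever, [m] terms in [P] could be put before [m] terms
   outside it; the tail only secures injectivity. *)
pose f i := if i < m then g2 i else if i < m.*2 then g1 i else g1 m.*2 + g2 m.*2 + i.
have g12 i j : g1 i <> g2 j by move=> e; apply: (g1P i); rewrite e.
have l1 i : i < m.*2 -> g1 i < g1 m.*2 by exact: hg1.
have l2 i : i < m.*2 -> g2 i < g2 m.*2 by exact: hg2.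
have fi : injective f.
  move=> i j; rewrite /f.
  case: (ltnP i m.*2) => im2; case: (ltnP j m.*2) => jm2.
  - case: (ltnP i m) => im; case: (ltnP j m) => jm.
    + exact: homo_inj hg2 _ _.
    + by move=> /esym /g12.
    + by move=> /g12.
    + exact: homo_inj hg1 _ _.
  - rewrite (ltnNge j) (leq_trans _ jm2) //=; last by lia.
    by have := l1 _ im2; have := l2 _ im2; case: (i < m); lia.
  - rewrite (ltnNge i) (leq_trans _ im2) //=; last by lia.
    by have := l1 _ jm2; have := l2 _ jm2; case: (j < m); lia.
  - rewrite (ltnNge j) (leq_trans _ jm2) //=; last by lia.
    by rewrite (ltnNge i) (leq_trans _ im2) //=; lia.
apply: (hm _ (ix fi)); split=> k hk; rewrite /= /f.
  by rewrite hk; exact: g2P.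
case/andP: hk => mk ->; rewrite ltnNge mk /=; exact: g1P.
Qed.

(** For [k] beyond the rows that a formula mentions, [x k] put in front of these rows is a
    re-enumeration without repetition, so a formula true of [x] holds there; hence it belongs to the
    average as a condition on the new first term. *)
Lemma iset_prepend c : realizes_over (average x) (A `|` range (flat x)) c ->
  eqtp A (flat x) (flat (prepend c x)).
Proof.
move=> hc; suff : eqtp (A `|` range (of_void M)) (flat x) (flat (prepend c x)).
  by apply: eqtp_mono; exact: subsetUl.
apply: rows_eqtp => n P dP Px.
have hr i a : (A `|` range (flat x)) (x i a) by right; exists (i, a).
pose h (z : 'I_n.+1 * X + void) : X + {m | (A `|` range (flat x)) m} :=
  match z with
  | inl y => if nat_of_ord y.1 is k.+1 then inr (exist _ _ (hr k y.2)) else inl y.2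
  | inr v => of_void _ v
  end.
have E v : copair (rows (prepend v x) (n := n)) (of_void M) = copair v sval \o h.
  by apply/funext => -[[[[|k] lk] a]|[]].
rewrite E; apply: (hc (fun v => P (copair v sval \o h))).
  exact: (def_plug h (@subsetUl _ _ _) dP).
exists n.+1 => k nk; rewrite -E.
pose f i := if i is j.+1 then (if j < k then j else j.+1) else k.
have fi : injective f.
  move=> [|i] [|j] //=; last case: (ltnP i k) => hi.
  - by case: (ltnP j k) => hj; lia.
  - by case: (ltnP i k) => hi; lia.
  - by case: (ltnP j k) => hj; lia.
  - by case: (ltnP j k) => hj; lia.
have := ix fi => /(eqtp_comp (f := fun z : 'I_n.+1 * X => (nat_of_ord z.1, z.2))) e.
have E2 : rows (prepend (x k) x) (n := n) =
    flat (x \o f) \o fun z : 'I_n.+1 * X => (nat_of_ord z.1, z.2).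
  apply/funext => -[[[|i] li] a]; rewrite /rows /flat //=.
  by rewrite ifT //; lia.
rewrite E2; have e' : eqtp (A `|` range (of_void M)) (rows x (n := n))
    (flat (x \o f) \o fun z : 'I_n.+1 * X => (nat_of_ord z.1, z.2)).
  apply: eqtp_mono e => y [//|[[]]].
by move/eqtp_add: e'; exact.
Qed.

End Iset.

Lemma average_chain X (A B : set M) (x : nat -> X -> M) (c : nat -> X -> M) :
  iset A x -> A `|` range (flat x) `<=` B ->
  (forall m, realizes_over (average x) (B `|` history c m) (c m)) ->
  forall m, eqtp A (flat x) (flat (prepends c m x)).
Proof.
move=> ix AB hc; elim=> [//|m IH /=].
apply: (eqtp_trans IH); apply: iset_prepend; first exact: (iset_eqtp IH ix).
move=> P dP /average_prepends; apply: hc; apply: def_mono dP => y [Ay|[[k a] _ <-]].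
  by left; apply: AB; left.
rewrite /flat /=; case: (ltnP k m) => km.
  by rewrite prepends_lt //; right; exists (m - k.+1), a; split=> //; lia.
have -> : k = m + (k - m) by rewrite subnKC.
by rewrite prepends_ge; left; apply: AB; right; exists (k - m, a).
Qed.

(** Terms of the chain followed by terms from a tail of [y] would form the cut excluded by
    [iset_cut_set]. *)
Lemma chain_average X (A : set M) (x y : nat -> X -> M) (c : nat -> X -> M) P :
  small K A -> small K [set: X] -> iset A x ->
  definable setT P -> (forall m, eqtp A (flat x) (flat (prepends c m y))) ->
  (forall k, P (c k)) -> ~ average y (~` P).
Proof.
move=> sA sX ix dP e Pc [N hN]; have [m hm] := iset_cut_set sA sX ix dP.
pose f i := if i < m then i else N + i.
have fi : injective f.
  by move=> i j; rewrite /f; case: (ltnP i m) => im; case: (ltnP j m) => jm; lia.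
apply: (hm (prepends c m y \o f)).
  exact: eqtp_trans (e m) (iset_eqtp (e m) ix fi).
split=> k km; rewrite /= /f.
  by rewrite km prepends_lt.
rewrite ltnNge; case/andP: km => mk _; rewrite mk /=.
have -> : N + k = m + (N + (k - m)) by lia.
by rewrite prepends_ge; apply: hN; lia.
Qed.

(* A sequence realizing F over everything can be put in front of x without
   destroying total indiscernibility; if some P in F failed at almost all x_k it
   would cut this indiscernible set, which NIP forbids. *)
Lemma nonforking_average X (A : set M) (x : nat -> X -> M) (F : set_system (X -> M)) :
  small K A -> small K [set: X] -> iset A x -> global_type F -> nonforking A F ->
  (forall P, definable (A `|` range (flat x)) P -> average x P -> F P) ->
  forall P, definable setT P -> F P -> average x P.
Proof.
move=> sA sX ix gF nF hF P dP FP.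
case: (average_global sA sX ix) => _ /(_ P dP)[//|nP]; exfalso.
have [E sE dE] := definable_small dP.
have sB : small K (A `|` range (flat x) `|` E).
  by apply: small_setU => //; apply: small_setU => //; exact: small_flat.
have [c hc] := chain_realized sB sX gF.
apply: (chain_average (c := c) (x := x) sA sX ix dP _ _ nP); last first.
  by move=> k; apply: (hc k) => //; apply: def_mono dE => y Ey; left; right.
elim=> [//|m IH /=].
have iy := iset_eqtp IH ix.
have rF : realizes_over F (A `|` range (flat (prepends c m x))) (c m).
  apply: realizes_over_mono (hc m) => y [Ay|[[k a] _ <-]]; first by do 3 left.
  rewrite /flat /=; case: (ltnP k m) => km.
    by rewrite prepends_lt //; right; exists (m - k.+1), a; split=> //; lia.
  have -> : k = m + (k - m) by rewrite subnKC.
  by rewrite prepends_ge; left; left; right; exists (k - m, a).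
(* Over [A] and [c m], the sequence built so far looks like its tail [x]. So it suffices to put
   [c m] directly in front of [x], where [F] agrees with the average. *)
have im := nonforking_iset hM hNIP sA sX gF nF iy rF.
have hx : eqtp A (flat x) (flat (prepend (c m) x)).
  apply: iset_prepend => // Q dQ avQ; apply: (hc m); last exact: hF.
  by apply: def_mono dQ => y h; left; left.
apply: eqtp_trans hx _; apply: eqtp_prepend; apply: eqtp_sym.
have -> : flat x = flat (prepends c m x \o [eta addn m]).
  by apply/funext => -[k a]; rewrite /flat /= prepends_ge.
by apply: im => i j /addnI.
Qed.

(* A sequence realizing the average of x 0 over everything sees x 0 and x 1 in
   the same way, because that average does not fork over A. *)
Lemma average_iseq X (A : set M) (x : nat -> nat -> X -> M) :
  small K A -> small K [set: X] -> iset A (x 0) -> nonforking A (average (x 0)) ->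
  iseq A (fun k => flat (x k)) ->
  forall P, definable setT P -> average (x 0) P -> average (x 1) P.
Proof.
move=> sA sX i0 n0 ix P dP avP.
have g0 := average_global sA sX i0.
have e01 (B : set M) : iseq B (fun k => flat (x k)) -> eqtp B (flat (x 0)) (flat (x 1)).
  move=> iB; have hS : {homo S : i j / (i < j)%N} by [].
  exact: (eqtp_comp (f := fun z => (0, z)) (iB S hS)).
have i1 : iset A (x 1) by exact: (iset_eqtp (e01 _ ix) i0).
case: (average_global sA sX i1) => _ /(_ P dP)[//|nP]; exfalso.
have [E sE dE] := definable_small dP.
pose B := A `|` range (flat (fun k => flat (x k))) `|` E.
have sXn : small K [set: nat * X] by exact: small_prod.
have sB : small K B.
  by apply: small_setU => //; apply: small_setU => //; exact: small_flat.
have [c hc] := chain_realized sB sX g0.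
(* The base absorbs the chain term by term, the average being nonforking over every larger base.
   Hence [x 0] and [x 1] have the same type over [A] and the chain, and what fits in front of [x 0]
   also fits in front of [x 1]. *)
have hi m : iseq (A `|` history c m) (fun k => flat (x k)).
  elim: m => [|m IH]; first by apply: iseq_mono ix => y [//|[j [a []]]].
  have sH : small K (A `|` history c m) by apply: small_setU => //; exact: small_history.
  have nH : nonforking (A `|` history c m) (average (x 0)) by apply: nonforking_base n0.
  have rH : realizes_over (average (x 0))
      ((A `|` history c m) `|` range (flat (fun k => flat (x k)))) (c m).
    apply: realizes_over_mono (hc m) => y [[Ay|hy]|ry]; [by do 3 left|by right|].
    by left; left; right.
  apply: iseq_mono (nonforking_iseq hM hNIP sH sXn g0 nH IH rH).
  move=> y [Ay|[j [a [+ ->]]]]; first by left; left.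
  rewrite ltnS leq_eqVlt => /orP[/eqP ->|jm]; first by right; exists a.
  by left; right; exists j, a.
apply: (chain_average (c := c) (x := x 0) sA sX i0 dP _ _ nP); last first.
  by move=> k; apply: (hc k) => //; apply: def_mono dE => y Ey; left; right.
move=> m; apply: eqtp_trans (average_chain (B := B) i0 _ hc m) _.
  by move=> y [Ay|[[k a] _ <-]]; left; [left|right; exists (0, (k, a))].
apply: (@eqtp_mono _ _ A (A `|` history c m)); first exact: subsetUl.
by apply: eqtp_prepends; exact: (e01 _ (hi m)).
Qed.

End NIP.
End Average.

(** * Extracting indiscernible sequences *)

Section IteratedLimit.
Variable V : set_system nat.
Hypotheses (uV : UltraFilter V) (Vge : forall b, V [set i | b <= i]).

Let pV : ProperFilter V. Proof. exact: ultra_proper. Qed.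

Definition stream_cons (i : nat) (f : nat -> nat) (k : nat) : nat :=
  if k is j.+1 then f j else i.

(* [iter_lim N E]: for V-almost all i_0, for V-almost all i_1, and so on up to
   i_(N-1), all sequences starting with i_0, ..., i_(N-1) are in E. *)
Fixpoint iter_lim N (E : set (nat -> nat)) : Prop :=
  if N is N'.+1 then V [set i | iter_lim N' [set f | E (stream_cons i f)]] else forall f, E f.

Lemma iter_lim_sub N (E E' : set (nat -> nat)) : E `<=` E' -> iter_lim N E -> iter_lim N E'.
Proof.
elim: N E E' => [|N IH] E E' EE' /=; first by move=> h f; exact/EE'.
by apply: filterS => i; apply: IH => f; exact: EE'.
Qed.

Lemma iter_limT N (E : set (nat -> nat)) : (forall f, E f) -> iter_lim N E.
Proof.
elim: N E => [//|N IH] E h /=; apply: (filterS _ filterT) => i _.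
by apply: IH => f; exact: h.
Qed.

Lemma iter_lim_le N N' (E : set (nat -> nat)) : N <= N' -> iter_lim N E -> iter_lim N' E.
Proof.
elim: N N' E => [|N IH] [|N'] E //=; first by move=> _ h; exact: (@iter_limT N'.+1 E h).
by rewrite ltnS => le; apply: filterS => i; exact: IH.
Qed.

Lemma iter_limI N (E E' : set (nat -> nat)) :
  iter_lim N E -> iter_lim N E' -> iter_lim N (E `&` E').
Proof.
elim: N E E' => [|N IH] E E' /= h h'; first by move=> f; split.
by apply: filterS (filterI h h') => i [Ei E'i]; exact: IH.
Qed.

Lemma iter_lim_ex N (E : set (nat -> nat)) : iter_lim N E -> exists f, E f.
Proof.
elim: N E => [|N IH] E /=; first by move=> /(_ id); exists id.
by move=> /filter_ex[i /IH[f]]; exists (stream_cons i f).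
Qed.

Definition depends_below N (E : set (nat -> nat)) : Prop :=
  forall f g : nat -> nat, (forall k, k < N -> f k = g k) -> E f -> E g.

Lemma depends_stream_cons N (E : set (nat -> nat)) i :
  depends_below N.+1 E -> depends_below N [set f | E (stream_cons i f)].
Proof. by move=> h f g fg; apply: h => -[|k] //=; exact: fg. Qed.

Lemma iter_lim_decide N (E : set (nat -> nat)) :
  depends_below N E -> iter_lim N E \/ iter_lim N (~` E).
Proof.
elim: N E => [|N IH] E hE /=.
  have [Ei|nE] := pselect (E id); [left|right] => f; first exact: hE Ei.
  by move=> Ef; apply: nE; exact: hE Ef.
have [h|h] := in_ultra_setVsetC [set i | iter_lim N [set f | E (stream_cons i f)]] uV.
  by left.
right; apply: filterS h => i ni.
by case: (IH _ (depends_stream_cons (i := i) hE)).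
Qed.

(** [V] contains every final segment, so each index may be taken above its predecessor; [b] carries
    this lower bound through the induction. *)
Lemma iter_lim_increasing N (E : set (nat -> nat)) b : depends_below N E ->
  (forall f, {homo f : i j / (i < j)%N} -> b <= f 0 -> E f) -> iter_lim N E.
Proof.
elim: N E b => [|N IH] E b hE h /=.
  move=> f; apply: hE (h [eta addn b] _ _) => //; last by rewrite addn0.
  by move=> i j; rewrite ltn_add2l.
apply: filterS (Vge b) => i bi; apply: (IH _ i.+1 (depends_stream_cons (i := i) hE)).
move=> f hf fi; apply: h => //=.
apply: homo_ltn => [|[|k] //=]; first exact: ltn_trans.
exact: hf.
Qed.

Lemma iter_lim_shift a m (E : set (nat -> nat)) :
  iter_lim m E -> iter_lim (a + m) [set f : nat -> nat | E (fun k => f (a + k))].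
Proof.
elim: a => [//|a IH] h /=; apply: (filterS _ filterT) => i _.
exact: IH.
Qed.

(** Limits over the indices skipped by [g] are vacuous. This invariance plays the part of Ramsey's
    theorem in the extraction. *)
Lemma iter_lim_comp N (E : set (nat -> nat)) g : {homo g : i j / (i < j)%N} ->
  iter_lim N E -> iter_lim (g N) [set f : nat -> nat | E (f \o g)].
Proof.
elim: N E g => [|N IH] E g hg; first by move=> h; apply: iter_limT => f; exact: h.
set a := g 0; pose g' k := g k.+1 - a.+1.
have ga k : a < g k.+1 by exact: hg.
have hg' : {homo g' : i j / (i < j)%N}.
  by move=> i j ij; have := ga i; have := hg i.+1 j.+1 ij; rewrite /g'; lia.
have -> : g N.+1 = a + (g' N).+1 by have := ga N; rewrite /g'; lia.
move=> /= h.
have : iter_lim (g' N).+1 [set f : nat -> nat | E (fun k => f (g k - a))].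
  apply: filterS h => i /(IH _ _ hg'); apply: iter_lim_sub => f /=.
  suff -> : stream_cons i (f \o g') = fun k => stream_cons i f (g k - a) by [].
  apply/funext => -[|k] /=; first by rewrite subnn.
  by have -> : g k.+1 - a = (g' k).+1 by have := ga k; rewrite /g'; lia.
move=> /(@iter_lim_shift a); apply: iter_lim_sub => f /=.
suff -> : (fun k => f (a + (g k - a))) = f \o g by [].
apply/funext => -[|k] /=; first by rewrite subnn addn0.
by rewrite subnKC //; exact: ltnW.
Qed.

End IteratedLimit.

Section IndiscernibleExtraction.
Variables (L : language) (M : structure L) (K : Type).
Hypothesis hM : monster M K.

Let hnat : small K [set: nat] := monster_nat hM.
Let hSL : strong_limit K. Proof. by case: hM. Qed.

(** The formulas true of [x] in the iterated limit are consistent. A realization of them is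
    indiscernible by [iter_lim_comp] and keeps what all increasing subsequences share by
    [iter_lim_increasing]. *)
Lemma iseq_extraction X (B : set M) (x : nat -> X -> M) :
  small K B -> small K [set: X] ->
  exists2 y : nat -> X -> M, iseq B y & forall P, definable B P ->
    (forall f : nat -> nat, {homo f : i j / (i < j)%N} -> P (flat (x \o f))) -> P (flat y).
Proof.
move=> sB sX.
have pE : ProperFilter [set S : set nat | exists b, forall i, b <= i -> S i].
  split; last split.
  - by case=> N /(_ N (leqnn N)).
  - by exists 0.
  - move=> P Q [N hN] [N' hN']; exists (maxn N N') => k; rewrite geq_max => /andP[h h'].
    by split; [exact: hN|exact: hN'].
  - by move=> P Q PQ [N hN]; exists N => k /hN; exact: PQ.
have [V [uV hV]] := ultraFilterLemma pE.
have Vge b : V [set i | b <= i] by apply: hV; exists b.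
pose Ex (P : set (nat * X -> M)) : set (nat -> nat) := [set f | P (flat (x \o f))].
pose F : set_system (nat * X -> M) := [set P | exists N, iter_lim V N (Ex P)].
have pF : ProperFilter F.
  split; last split.
  - by case=> N /(iter_lim_ex uV)[].
  - by exists 0.
  - move=> P Q [N hN] [N' hN']; exists (maxn N N'); apply: (iter_limI uV).
      by apply: (iter_lim_le uV) hN; exact: leq_maxl.
    by apply: (iter_lim_le uV) hN'; exact: leq_maxr.
  - by move=> P Q PQ [N hN]; exists N; apply: (iter_lim_sub uV) hN => f; exact: PQ.
have sXn : small K [set: nat * X] by exact: small_prod.
have [w hw] := filter_realized hM sXn sB pF.
pose y k a := w (k, a).
have yw : flat y = w by apply/funext => -[].
have dep P : definable B P -> exists N, depends_below N (Ex P).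
  move=> dP; have [s hs] := def_support dP.
  have [N hN] : exists N, forall i a, In (i, a) s -> i < N.
    elim: (s) => [|[j b] l [N IH]]; first by exists 0.
    exists (maxn j.+1 N) => i a [[-> _]|/IH]; first exact: leq_maxl.
    by move=> h; exact: leq_trans h (leq_maxr _ _).
  exists N => f g fg; apply: hs => -[i a] /hN iN.
  by rewrite /flat /= fg.
exists y => [g hg P dP|P dP hP]; rewrite yw; last first.
  apply: hw => //; have [N hN] := dep _ dP; exists N.
  by apply: (iter_lim_increasing uV Vge (b := 0) hN) => f hf _; exact: hP.
move=> Pw; have [N hN] := dep _ dP.
have [limP|limN] := iter_lim_decide uV hN; last first.
  by case: (hw _ (def_not dP)) => //; exists N.
have -> : flat (y \o g) = w \o (fun z => (g z.1, z.2)) by [].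
apply: (hw (fun w => P (w \o (fun z => (g z.1, z.2))))); first exact: def_comp.
by exists (g N); exact: (iter_lim_comp uV hg limP).
Qed.

Lemma realizes_over_eqtp X (F : set_system (X -> M)) (B : set M) (a b : X -> M) :
  global_type F -> realizes_over F B a -> realizes_over F B b -> eqtp B a b.
Proof. by move=> gF ha hb P dP /(realizes_overP gF ha dP); exact: hb. Qed.

(** Provides an independent copy of the same strong type. Successive copies of [c] realize a
    nonforking type over everything before, while [e] is merely carried along by homogeneity; then
    an indiscernible sequence is extracted. *)
Lemma morley_pair Y Z (A D : set M) (c : Y -> M) (e : Z -> M) :
  small K A -> small K D -> small K [set: Y] -> small K [set: Z] -> free c A D ->
  exists x : nat -> (Y + Z) -> M, [/\ iseq (A `|` D) x,
    eqtp (A `|` D) (copair c e) (x 0) &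
    free (x 1 \o inl) A (D `|` range (x 0))].
Proof.
move=> sA sD sY sZ /free_realizes[F [gF nF hc]].
have sAD : small K (A `|` D) by exact: small_setU.
have sYZ : small K [set: Y + Z] by exact: small_sum.
have [|x hx] := @dependent_choice_history (Y + Z -> M) (fun l u =>
    eqtp (A `|` D) (copair c e) u /\
    realizes_over F ((A `|` D) `|` [set y | exists d a, In d l /\ y = d a]) (u \o inl)).
  move=> l.
  have [|c' hc'] := filter_realized hM (B := (A `|` D) `|`
      [set y | exists d a, In d l /\ y = d a]) sY _ gF.1.
    apply: small_setU => //.
    apply: (small_sub (B := \bigcup_(d in [set d | In d l]) range d)).
      by move=> _ [d [a [dl ->]]]; exists d.
    elim: l => [|d l IH].
      by apply: (small_rel (R := fun _ _ => True) hnat) => [y [d []]|y y' n [d []]].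
    apply: (small_sub (B := range d `|` \bigcup_(d in [set d | In d l]) range d)).
      by move=> y [e' [<-|el] ry]; [left|right; exists e'].
    by apply: small_setU => //; exact: small_image.
  have ec : eqtp (A `|` D) c c'.
    by apply: (realizes_over_eqtp gF hc) => P dP; apply: hc'; exact: def_mono dP.
  have [e' he'] := eqtp_extend hM e sY sAD ec.
  by exists (copair c' e').
have [y iy hy] := iseq_extraction x sAD sYZ.
have xe i : eqtp (A `|` D) (copair c e) (x i) by have [] := hx i.
have ye : eqtp (A `|` D) (copair c e) (y 0).
  move=> P dP Pce.
  apply: (hy _ (def_comp (fun a => (0, a)) dP)) => f hf.
  exact: (xe (f 0)).
exists y; split=> //; apply/freeP => P dP Py fP.
have {}dP : definable ((A `|` D) `|` range (y 0)) P by apply: def_mono dP; rewrite setUA.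
have [Q dQ eQ] := def_split dP.
pose r (z : Y + (Y + Z)) : nat * (Y + Z) :=
  match z with inl a => (1, inl a) | inr b => (0, b) end.
have E x' : flat x' \o r = copair (x' 1 \o inl) (x' 0) by apply/funext => -[].
(* A forking formula relating [y 1] to [y 0] must already hold at two terms of [x], where the later
   one realizes the nonforking [F] over the earlier one. *)
have [f hf Qf] : exists2 f : nat -> nat, {homo f : i j / (i < j)%N} &
    Q (copair (x (f 1) \o inl) (x (f 0))).
  apply: contrapT => nf.
  have := hy _ (def_not (def_comp r dQ)); rewrite /setC /= E => h.
  apply: h; last exact/eQ.
  by move=> f hf; rewrite E => Qf; apply: nf; exists f.
have [_ rF] := hx (f 1).
have fQ : forking_set A (fun v => Q (copair v (y 0))).
  by have [d [delta [hd h]]] := fP; exists d, delta; split=> // v /eQ; exact: h.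
have /(forking_set_eqtp hM sYZ sAD (@subsetUl _ _ _) dQ)/(_ fQ) :
  eqtp (A `|` D) (y 0) (x (f 0)) by exact: eqtp_trans (eqtp_sym ye) (xe _).
apply: (nonforking_set gF nF); apply/(realizes_overP gF rF) => //.
apply: def_fiber dQ; first exact: subsetUl.
move=> a; right; exists (x (f 0)), a; split=> //; apply/In_mkseq; exists (f 0) => //.
exact: hf.
Qed.

End IndiscernibleExtraction.

(** * Generic stability and co-domination *)

Section Symmetry.
Variables (L : language) (M : structure L) (K : Type).
Hypothesis hM : monster M K.
Hypothesis hNIP : forall n m (phi : form L ('I_n + 'I_m)), ~ has_IP M phi.
Variable A : set M.
Hypotheses (sA : small K A) (hbase : extension_base K A).

Let hnat : small K [set: nat] := monster_nat hM.
Let hSL : strong_limit K. Proof. by case: hM. Qed.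

Lemma tp_complete X (a : X -> M) : complete_type A (tp a A).
Proof.
split=> [th [] //|n th h|th ov]; first by exists a => i; have [] := h i.
by have [h|h] := pselect (psat a th); [left|right].
Qed.

Lemma free_base X (a : X -> M) : small K [set: X] -> free a A set0.
Proof.
by move=> sX; apply/indepP; rewrite /indep setU0; apply: hbase (tp_complete a).
Qed.

Lemma nonforking_average_aut X (s : M -> M) (x : nat -> X -> M) :
  automorphism s -> (forall m, A m -> s m = m) -> nonforking A (average x) ->
  nonforking A (average (fun k => s \o x k)).
Proof.
move=> sM fixA nF th hth [N h]; have [th' h1 h2] := aut_pform th sM fixA.
by apply: (nF th' (h1 hth)); exists N => k /h /h2.
Qed.

Lemma nonforking_average_eqtp X (x y : nat -> X -> M) : small K [set: X] ->
  eqtp A (flat x) (flat y) -> nonforking A (average x) -> nonforking A (average y).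
Proof.
move=> sX e nx; have sXn : small K [set: nat * X] by exact: small_prod.
have [s [sM fixA ey]] := homogeneity hM sXn sA e.
suff -> : y = fun k => s \o x k by exact: nonforking_average_aut.
by apply/funext => k; apply/funext => a; exact: (congr1 (fun f => f (k, a)) (esym ey)).
Qed.

Lemma average_iseq_iff X (x : nat -> nat -> X -> M) : small K [set: X] ->
  iset A (x 0) -> nonforking A (average (x 0)) -> iseq A (fun k => flat (x k)) ->
  forall P, definable setT P -> (average (x 1) P <-> average (x 0) P).
Proof.
move=> sX i0 n0 ix P dP; split=> [h1|]; last exact: (average_iseq hM hNIP sA sX i0 n0 ix dP).
have [_ g0] := average_global hM hNIP sA sX i0.
have [//|h0] := g0 P dP.
have [N hN] := average_iseq hM hNIP sA sX i0 n0 ix (def_not dP) h0.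
have [N' hN'] := h1; case: (hN (maxn N N')); first exact: leq_maxl.
by apply: hN'; exact: leq_maxr.
Qed.

(* With (d', x') independent from (d, x) and of the same strong type, the
   averages of x and x' agree, so (d', x 0) has the type of (d, x 0), while d'
   is free from x 0. *)
Lemma free_of_indiscernible X Z (x : nat -> X -> M) (d : Z -> M) :
  small K [set: X] -> small K [set: Z] -> iset A x -> nonforking A (average x) ->
  (forall k, eqtp A (copair d (x 0)) (copair d (x k))) -> free d A (range (x 0)).
Proof.
move=> sX sZ ix nx hd.
have sXn : small K [set: nat * X] by exact: small_prod.
have sY : small K [set: Z + nat * X] by exact: small_sum.
have s0 : small K [set: void].
  by apply: (small_rel (R := fun _ _ => True) hnat) => -[].
have sE : small K (@set0 M) by apply: (small_rel (R := fun _ _ => True) hnat) => y.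
pose c := copair d (flat x).
(* Here the extension base enters: the pair of [d] and all of [x] is free over [A]. Nothing has to
   be carried along, hence the empty tuple. *)
have [u [iu u0 u1]] := morley_pair hM (of_void M) sA sE sY s0 (free_base c sY).
have setA0 : A `|` set0 = A by rewrite setU0.
rewrite setA0 in iu u0; rewrite set0U in u1.
pose dd k := u k \o inl \o inl.
pose xx k i a := u k (inl (inr (i, a))).
have fxx k : flat (xx k) = u k \o inl \o inr by apply/funext => -[].
have cu k : eqtp A c (u k \o inl).
  apply: eqtp_trans (eqtp_comp (f := inl) u0) _.
  have hk : {homo [eta addn k] : i j / (i < j)%N} by move=> i j; rewrite ltn_add2l.
  have := eqtp_comp (f := fun y => (0, inl y)) (iu _ hk).
  have -> : flat (u \o [eta addn k]) \o (fun y => (0, inl y)) = u k \o inl.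
    by apply/funext => y; rewrite /flat /= addn0.
  exact.
have exx k : eqtp A (flat x) (flat (xx k)).
  by rewrite fxx; exact: (eqtp_comp (f := inr) (cu k)).
have i0 := iset_eqtp (exx 0) ix.
have n0 := nonforking_average_eqtp sX (exx 0) nx.
have ixx : iseq A (fun k => flat (xx k)).
  have -> : (fun k => flat (xx k)) = fun k => u k \o (fun z => inl (inr z)).
    by apply/funext => k; rewrite fxx.
  exact: iseq_proj.
have agree := average_iseq_iff sX i0 n0 ixx.
have eu k i : eqtp A (copair d (x i)) (copair (dd k) (xx k i)).
  pose r (z : Z + X) : Z + nat * X := match z with inl y => inl y | inr a => inr (i, a) end.
  have := eqtp_comp (f := r) (cu k).
  have -> : c \o r = copair d (x i) by apply/funext => -[].
  suff -> : (u k \o inl) \o r = copair (dd k) (xx k i) by [].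
  by apply/funext => -[].
have fd1 : free (dd 1) A (range (u 0)) by exact: (free_comp inl u1).
have [F [gF nF rF]] := free_realizes fd1.
have i01 : iset (A `|` range (dd 1)) (xx 0).
  apply: (nonforking_iset hM hNIP sA sX gF nF i0).
  apply: realizes_over_mono rF; apply: setUS => _ [[i a] _ <-].
  by exists (inl (inr (i, a))).
(* A formula true of [dd 0] and [xx 0 0] holds of [dd 1] with every [xx 1 i], so it lies in the
   common average and holds of [dd 1] with some [xx 0 N]. Total indiscernibility of [xx 0] over
   [dd 1] brings [N] back to [0]. *)
have e01 : eqtp A (copair (dd 0) (xx 0 0)) (copair (dd 1) (xx 0 0)).
  move=> P dP P0.
  have P1 i : P (copair (dd 1) (xx 1 i)).
    apply: (eu 1 i _ dP); apply: (hd i _ dP); exact: (eqtp_sym (eu 0 0) dP P0).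
  have dP1 : definable setT (fun v => P (copair (dd 1) v)).
    pose sw (z : Z + X) : X + Z := match z with inl y => inr y | inr a => inl a end.
    have := def_fiber (w := dd 1) (@subsetT _ A) (fun _ => I) (def_comp sw dP).
    apply: def_ext => v.
    suff -> : copair v (dd 1) \o sw = copair (dd 1) v by [].
    by apply/funext => -[].
  have [N hN] : average (xx 0) (fun v => P (copair (dd 1) v)).
    by apply/agree => //; exists 0.
  pose f i := N + i.
  have fi : injective f by move=> i j /addnI.
  have := i01 f fi => /(eqtp_comp (f := fun a : X => (0, a))) => e.
  have {}e : eqtp (A `|` range (dd 1)) (xx 0 N) (xx 0 0).
    have := eqtp_sym e; have -> : flat (xx 0 \o f) \o (fun a => (0, a)) = xx 0 N.
      by apply/funext => a; rewrite /flat /= /f addn0.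
    exact.
  move/eqtp_add : e => e.
  pose sw (z : Z + X) : X + Z := match z with inl y => inr y | inr a => inl a end.
  have E v : copair v (dd 1) \o sw = copair (dd 1) v by apply/funext => -[].
  by have := eqtp_comp (f := sw) e; rewrite !E; apply => //; exact: hN.
have fd : free (dd 1) A (range (xx 0 0)).
  by apply: free_mono fd1 => _ [a _ <-]; exists (inl (inr (0, a))).
apply: (free_eqtp hM sX sA _ fd).
exact: eqtp_trans (eqtp_sym e01) (eqtp_sym (eu 0 0)).
Qed.

(** A chain grows to the left, yet it is needed as a sequence in order of construction. Total
    indiscernibility reverses each finite piece, and types are determined by finite pieces. *)
Lemma prepends_rev_eqtp X (B : set M) (y z : nat -> X -> M) (c : nat -> X -> M) :
  iset B y -> (forall m, eqtp B (flat y) (flat (prepends c m z))) ->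
  eqtp B (flat y) (flat c) /\ eqtp B (flat y) (flat (prepend (z 0) c)).
Proof.
move=> iy hc; split; apply: eqtp_finite => s.
all: have [n hn] : exists n, forall i a, In (i, a) s -> i <= n.
1, 3: elim: (s) => [|[j b] l [n IH]]; first (by exists 0); exists (maxn j n) => i a [[-> _]|/IH];
  [exact: leq_maxl|by move=> h; exact: leq_trans h (leq_maxr _ _)].
  pose m := n.+1; pose f i := if i < m then m - i.+1 else i.
  have fi : injective f.
    by move=> i j; rewrite /f; case: (ltnP i m) => hi; case: (ltnP j m) => hj; lia.
  exists (flat y), (flat (prepends c m z \o f)); split=> // [|[i a] /hn le].
    exact: eqtp_trans (hc m) (iset_eqtp (hc m) iy fi).
  change (c i a = prepends c m z (f i) a); have -> : f i = m - i.+1 by rewrite /f ltnS le.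
  by rewrite prepends_lt; [congr c|]; rewrite /m; lia.
pose m := n.+1; pose f i := if i is j.+1 then (if j < m then m - j.+1 else i) else m.
have fi : injective f.
  move=> [|i] [|j] //=; rewrite /f.
  - by case: (ltnP j m) => hj; lia.
  - by case: (ltnP i m) => hi; lia.
  - by case: (ltnP i m) => hi; case: (ltnP j m) => hj; lia.
exists (flat y), (flat (prepends c m z \o f)); split=> // [|[[|i] a] /hn le].
- exact: eqtp_trans (hc m) (iset_eqtp (hc m) iy fi).
- by change (z 0 a = prepends c m z m a); rewrite -{2}(addn0 m) prepends_ge.
- change (c i a = prepends c m z (f i.+1) a).
  have -> : f i.+1 = m - i.+1 by rewrite /f ifT // /m; lia.
  by rewrite prepends_lt; [congr c|]; rewrite /m; lia.
Qed.

End Symmetry.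

(** * Copies of the co-dominated tuple with a chain above them, and symmetry *)

Section CoDomination.
Variables (L : language) (M : structure L) (K : Type).
Hypothesis hM : monster M K.
Hypothesis hNIP : forall n m (phi : form L ('I_n + 'I_m)), ~ has_IP M phi.
Variable A : set M.
Hypotheses (sA : small K A) (hbase : extension_base K A).

Let hnat : small K [set: nat] := monster_nat hM.
Let hSL : strong_limit K. Proof. by case: hM. Qed.

(* A sequence xi realizing the common average of y and z has the type of y over
   A c, and z 0 can be put in front of it; moving xi to y over A c moves z 0 to
   the required b. *)
Lemma move_into_chain X Y (y z : nat -> X -> M) (c : Y -> M) :
  small K [set: X] -> small K [set: Y] ->
  iset (A `|` range c) y -> iset A z ->
  (forall P, definable setT P -> average y P <-> average z P) ->
  exists b, eqtp A (copair c (z 0)) (copair c b) /\ eqtp A (flat z) (flat (prepend b y)).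
Proof.
move=> sX sY iy iz yz.
have sXn : small K [set: nat * X] by exact: small_prod.
have iyA : iset A y by apply: iset_mono iy; exact: subsetUl.
have sc : small K (A `|` range c) by apply: small_setU => //; exact: small_image.
have gy := average_global hM hNIP sA sX iyA.
pose B := A `|` range c `|` (range (flat y) `|` range (flat z)).
have sB : small K B.
  by apply: small_setU => //; apply: small_setU => //; exact: (small_flat hM).
have [xi hxi] := chain_realized hM sB sX gy.
have hxiz m : realizes_over (average z) (B `|` history xi m) (xi m).
  move=> P dP avP; apply: hxi => //; apply/yz => //.
  by apply: def_mono dP; exact: subsetT.
have By : (A `|` range c) `|` range (flat y) `<=` B.
  by move=> m [h|h]; [left|right; left].
have Bz : A `|` range (flat z) `<=` B.
  by move=> m [h|h]; [left; left|right; right].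
have [e1 _] := prepends_rev_eqtp iy (average_chain iy By hxi).
have [_ e2] := prepends_rev_eqtp iz (average_chain iz Bz hxiz).
have [s [sM fix_s es]] := homogeneity hM sXn sc (eqtp_sym e1).
have fixA m : A m -> s m = m by move=> Am; apply: fix_s; left.
exists (s \o z 0); split.
  have := eqtp_aut (a := copair c (z 0)) sM fixA.
  suff -> : s \o copair c (z 0) = copair c (s \o z 0) by [].
  by apply/funext => -[i|a] //=; apply: fix_s; right; exists i.
apply: eqtp_trans e2 _.
have := eqtp_aut (a := flat (prepend (z 0) xi)) sM fixA.
suff -> : s \o flat (prepend (z 0) xi) = flat (prepend (s \o z 0) y) by [].
apply/funext => -[[|i] a] //; exact: (congr1 (fun f => f (i, a)) es).
Qed.

Lemma independent_copies X Y Z (beta : nat -> X -> M) (c : Y -> M) (d : Z -> M) :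
  small K [set: X] -> small K [set: Y] -> small K [set: Z] ->
  iset A beta -> nonforking A (average beta) -> free c A (range d) ->
  exists (b : nat -> X -> M) (cc : nat -> Y -> M),
    [/\ eqtp A (flat beta) (flat b),
        forall n, eqtp (A `|` range d) c (cc n) &
        forall n, eqtp A (copair c (beta 0)) (copair (cc n) (b n))].
Proof.
move=> sX sY sZ ib nb fc.
have sXn : small K [set: nat * X] by exact: small_prod.
have sD : small K (range d) by exact: small_image.
have sAD : small K (A `|` range d) by exact: small_setU.
have sYX : small K [set: Y + nat * X] by exact: small_sum.
have [u [iu u0 u1]] := morley_pair hM (flat beta) sA sD sY sXn fc.
pose xx k i a := u k (inr (i, a)).
have fxx k : flat (xx k) = u k \o inr by apply/funext => -[].
have uu k : eqtp (A `|` range d) (copair c (flat beta)) (u k).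
  apply: eqtp_trans u0 _.
  have hk : {homo [eta addn k] : i j / (i < j)%N} by move=> i j; rewrite ltn_add2l.
  have := eqtp_comp (f := fun y => (0, y)) (iu _ hk).
  have -> : flat (u \o [eta addn k]) \o (fun y => (0, y)) = u k.
    by apply/funext => y; rewrite /flat /= addn0.
  exact.
have AAD : A `<=` A `|` range d by exact: subsetUl.
have exx k : eqtp A (flat beta) (flat (xx k)).
  by apply: (eqtp_mono AAD); rewrite fxx; exact: (eqtp_comp (f := inr) (uu k)).
have i0 := iset_eqtp (exx 0) ib.
have n0 := nonforking_average_eqtp hM sA sX (exx 0) nb.
have ixx : iseq A (fun k => flat (xx k)).
  have -> : (fun k => flat (xx k)) = fun k => u k \o inr.
    by apply/funext => k; rewrite fxx.
  by apply: iseq_proj; apply: iseq_mono iu.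
have agree := average_iseq_iff hM hNIP sA sX i0 n0 ixx.
have [_ g0] := average_global hM hNIP sA sX i0.
have [F [gF nF rF]] := free_realizes u1.
pose prel (l : seq ((X -> M) * (Y -> M))) := foldl (fun y v => prepend v.1 y) (xx 0) l.
have avprel l P : average (prel l) P <-> average (xx 0) P.
  elim/last_ind: l => // l v IH; rewrite /prel foldl_rcons average_prepend; exact: IH.
pose G l := eqtp A (flat (xx 0)) (flat (prel l)).
(* The invariant [G l] is a premise so that every list has a successor, with a default value for the
   irrelevant lists. *)
have step l : exists v, G l -> [/\ eqtp (A `|` range d) c v.2,
    eqtp A (copair c (beta 0)) (copair v.2 v.1) & G (rcons l v)].
  have [Gl|nG] := pselect (G l); last by exists (beta 0, c).
  have iy := iset_eqtp Gl i0.
  have sB : small K (A `|` (range d `|` range (u 0))).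
    by apply: small_setU => //; apply: small_setU => //; exact: small_image.
  have sB' : small K (A `|` (range d `|` range (u 0)) `|` range (flat (prel l))).
    by apply: small_setU => //; exact: (small_flat hM).
  have [c' hc'] := filter_realized hM sY sB' gF.1.
  have e1 : eqtp (A `|` (range d `|` range (u 0))) (u 1 \o inl) c'.
    apply: (realizes_over_eqtp gF rF); apply: realizes_over_mono hc'; exact: subsetUl.
  have [s [sM fix_s es]] := homogeneity hM sY sB e1.
  have fixAD m : (A `|` range d) m -> s m = m.
    by move=> [Am|dm]; apply: fix_s; [left|right; left].
  have fixA m : A m -> s m = m by move=> Am; apply: fixAD; left.
  pose z k := s \o xx 1 k.
  have sx0 k : s \o xx 0 k = xx 0 k.
    by apply/funext => a; apply: fix_s; right; right; exists (inr (k, a)).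
  (* [s] fixes [xx 0], hence its average, which is also that of [xx 1]. So [z], the image of [xx 1]
     above [c'], has the average of the chain. *)
  have avz P : definable setT P -> average (prel l) P <-> average z P.
    move=> dP; rewrite avprel.
    have -> : average z P <-> average (fun k => s \o xx 0 k) P := agree _ (def_aut sM dP).
    suff -> : (fun k => s \o xx 0 k) = xx 0 by [].
    by apply/funext => k; exact: sx0.
  have ez : eqtp A (flat (xx 1)) (flat z) by exact: (eqtp_aut (a := flat (xx 1)) sM fixA).
  have iz : iset A z by apply: iset_eqtp ez (iset_eqtp (exx 1) ib).
  have rc' : realizes_over F (A `|` range (flat (prel l))) c'.
    by apply: realizes_over_mono hc' => m [Am|h]; [left; left|right].
  have iyc := nonforking_iset hM hNIP sA sX gF nF iy rc'.
  have [b [eb1 eb2]] := move_into_chain sX sY iyc iz avz.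
  exists (b, c') => _; split=> /=.
  - rewrite -es; apply: eqtp_trans (eqtp_aut (a := u 1 \o inl) sM fixAD).
    exact: (eqtp_comp (f := inl) (uu 1)).
  - apply: eqtp_trans eb1.
    have h1 : eqtp A (copair c (flat beta)) (s \o u 1).
      apply: eqtp_trans (eqtp_aut (a := u 1) sM fixA).
      exact: eqtp_mono AAD (uu 1).
    pose r (y : Y + X) : Y + nat * X := match y with inl y => inl y | inr a => inr (0, a) end.
    have := eqtp_comp (f := r) h1.
    have -> : copair c (flat beta) \o r = copair c (beta 0) by apply/funext => -[].
    suff -> : (s \o u 1) \o r = copair c' (z 0) by [].
    by rewrite -es; apply/funext => -[].
  - rewrite /G /prel foldl_rcons.
    apply: eqtp_trans (eqtp_sym (exx 0)) _; apply: eqtp_trans (exx 1) _.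
    exact: eqtp_trans ez eb2.
have [f hf] := dependent_choice_history step.
pose b k := (f k).1; pose cc k := (f k).2.
have prelE n : prel (mkseq f n) = prepends b n (xx 0).
  by elim: n => //= n IH; rewrite mkseqS /prel foldl_rcons -/(prel _) IH.
have hG n : G (mkseq f n).
  elim: n => [|n IH]; first by [].
  by rewrite mkseqS; have [] := hf n IH.
exists b, cc; split=> [|n|n]; try by have [] := hf n (hG n).
apply: eqtp_trans (exx 0) _.
have [] := prepends_rev_eqtp i0 (c := b) (z := xx 0) _ => // n.
by rewrite -prelE; exact: hG.
Qed.

(** Extraction over [A] and [d] makes the [b]-components all have the same type over [A] and [d], as
    [free_of_indiscernible] requires, and preserves the properties of the copies. *)
Lemma free_from_copy X Y Z (beta : nat -> X -> M) (c : Y -> M) (d : Z -> M) :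
  small K [set: X] -> small K [set: Y] -> small K [set: Z] ->
  iset A beta -> nonforking A (average beta) -> free c A (range d) ->
  exists (c' : Y -> M) (b : X -> M),
    [/\ eqtp (A `|` range d) c c', eqtp A (copair c (beta 0)) (copair c' b) &
        free d A (range b)].
Proof.
move=> sX sY sZ ib nb fc.
have [b [cc [eb hc hcb]]] := independent_copies sX sY sZ ib nb fc.
have sAD : small K (A `|` range d) by apply: small_setU => //; exact: small_image.
have sYX : small K [set: Y + X] by exact: small_sum.
have [y iy hy] := iseq_extraction hM (fun k => copair (cc k) (b k)) sAD sYX.
pose beta' k := y k \o inr.
have AAD : A `<=` A `|` range d by exact: subsetUl.
have ibb := iset_eqtp eb ib.
have eb' : eqtp A (flat beta) (flat beta').
  move=> P dP Pb; apply: (hy _ (def_comp (fun z => (z.1, inr z.2)) (def_mono AAD dP))).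
  move=> f hf; apply: (ibb f (homo_inj hf) P dP); exact: eb.
have ib' := iset_eqtp eb' ib.
exists (y 0 \o inl), (beta' 0); split.
- move=> P dP Pc; apply: (hy _ (def_comp (fun a => (0, inl a)) dP)) => f hf.
  exact: (hc (f 0) P dP).
- move=> P dP Pc.
  have := hy _ (def_comp (fun z : Y + X => (0, z)) (def_mono AAD dP)).
  have E (u : nat -> Y + X -> M) : flat u \o (fun z => (0, z)) = u 0 by [].
  rewrite E => h.
  have -> : copair (y 0 \o inl) (beta' 0) = y 0 by apply/funext => -[].
  by apply: h => f hf; apply: (hcb (f 0) P dP).
apply: (free_of_indiscernible hM hNIP sA hbase) => //.
  exact: (nonforking_average_eqtp hM sA sX eb' nb).
move=> k.
have hk : {homo [eta addn k] : i j / (i < j)%N} by move=> i j; rewrite ltn_add2l.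
have := eqtp_comp (f := fun a => (0, inr a)) (iy _ hk).
have -> : flat (y \o [eta addn k]) \o (fun a => (0, inr a)) = beta' k.
  by apply/funext => a; rewrite /flat /= addn0.
move=> /eqtp_add.
pose sw (z : Z + X) : X + Z := match z with inl y => inr y | inr a => inl a end.
have E v : copair v d \o sw = copair d v by apply/funext => -[].
by move=> /(eqtp_comp (f := sw)); rewrite !E.
Qed.

(** Co-domination is witnessed by one pair [a], [b]. So [beta] is moved to start with a partner of
    [c], the resulting copy [c'], [b'] is carried to [a], [b] together with [d], and the conclusion
    is carried back. *)
Lemma co_dominated_free X Y Z (p : set (pform M X)) (q : set (pform M Y))
    (beta : nat -> X -> M) (c : Y -> M) (d : Z -> M) :
  small K [set: X] -> small K [set: Y] -> small K [set: Z] ->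
  complete_type A p -> complete_type A q -> co_dominated K A q p ->
  iset A beta -> nonforking A (average beta) -> realizes (beta 0) p ->
  realizes c q -> free c A (range d) -> free d A (range c).
Proof.
move=> sX sY sZ hp hq [a [b [aq bp hcd]]] ib nb bp0 cq fc.
have ac : eqtp A a c by exact: ((realizes_eqtp _ hq aq).1 cq).
have [b1 eb1] := eqtp_extend hM b sY sA ac.
have b1p : eqtp A (beta 0) b1.
  apply: eqtp_trans (eqtp_comp (f := inr) eb1).
  exact: ((realizes_eqtp _ hp bp0).1 bp).
have [s [sM fixA es]] := homogeneity hM sX sA b1p.
pose beta1 k := s \o beta k.
have i1 : iset A beta1 by apply: iset_eqtp ib; exact: (eqtp_aut (a := flat beta) sM fixA).
have n1 := nonforking_average_aut sM fixA nb.
have [c' [b' [ec ecb fd]]] := free_from_copy sX sY sZ i1 n1 fc.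
have E0 : beta1 0 = b1 by [].
rewrite E0 in ecb.
have e : eqtp A (copair c' b') (copair a b) by exact: eqtp_sym (eqtp_trans eb1 ecb).
have sYX : small K [set: Y + X] by exact: small_sum.
have [d' ed] := eqtp_extend hM d sYX sA e.
pose rb (z : Z + X) : (Y + X) + Z := match z with inl y => inr y | inr a => inl (inr a) end.
pose ra (z : Z + Y) : (Y + X) + Z := match z with inl y => inr y | inr a => inl (inl a) end.
have Eb (u : Y -> M) v w : copair (copair u v) w \o rb = copair w v by apply/funext => -[].
have Ea (u : Y -> M) (v : X -> M) w : copair (copair u v) w \o ra = copair w u by apply/funext => -[].
have edb : eqtp A (copair d b') (copair d' b).
  by have := eqtp_comp (f := rb) ed; rewrite !Eb.
have eda : eqtp A (copair d c') (copair d' a).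
  by have := eqtp_comp (f := ra) ed; rewrite !Ea.
have fd' := free_eqtp hM sX sA edb fd.
have fda : free d' A (range a) by apply/indepP; apply: hcd => //; exact/indepP.
have fdc' : free d A (range c') by exact: (free_eqtp hM sY sA (eqtp_sym eda) fda).
apply: (free_eqtp hM sY sA _ fdc').
have /eqtp_add := eqtp_sym ec.
pose sw (z : Z + Y) : Y + Z := match z with inl y => inr y | inr a => inl a end.
have E v : copair v d \o sw = copair d v by apply/funext => -[].
by move=> /(eqtp_comp (f := sw)); rewrite !E.
Qed.

End CoDomination.

(** * The average of a generically stable type does not fork *)

Section GenericStability.
Variables (L : language) (M : structure L) (K : Type).
Hypothesis hM : monster M K.
Hypothesis hNIP : forall n m (phi : form L ('I_n + 'I_m)), ~ has_IP M phi.
Variable A : set M.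
Hypotheses (sA : small K A).

Let hnat : small K [set: nat] := monster_nat hM.
Let hSL : strong_limit K. Proof. by case: hM. Qed.

Lemma infinite_nat_inj (I : Type) : infinite_set [set: I] ->
  exists i : nat -> I, injective i.
Proof.
move=> /infiniteP h; have /smallP/contrapT[f [fi _]] : ~ small nat [set: I] by [].
by exists f.
Qed.

Lemma exists_last (d : Order.disp_t) (I : orderType d) (i : nat -> I) n :
  exists2 m, m <= n & forall j, j <= n -> (i j <= i m)%O.
Proof.
elim: n => [|n [m mn hm]].
  by exists 0 => // j; rewrite leqn0 => /eqP ->.
case: (Order.TotalTheory.leP (i n.+1) (i m)) => h.
  exists m => [|j]; first exact: leqW.
  by rewrite leq_eqVlt => /orP[/eqP -> //|]; rewrite ltnS; exact: hm.
exists n.+1 => // j; rewrite leq_eqVlt => /orP[/eqP -> //|]; rewrite ltnS => /hm jm.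
exact: Order.POrderTheory.le_trans jm (Order.POrderTheory.ltW h).
Qed.

Definition exchange (m n j : nat) : nat := if j == m then n else if j == n then m else j.

Lemma exchange_inj m n : injective (exchange m n).
Proof. move=> i j; rewrite /exchange.
by case: (i =P m); case: (i =P n); case: (j =P m); case: (j =P n); lia. Qed.

(** The injection of [nat] into the index order need not be monotone; this is harmless for an
    indiscernible set, but freeness refers to the order. Once the restriction of the average to [A]
    and the sequence is known not to fork, [nonforking_average] identifies its global nonforking
    extension with the average. *)
Lemma generically_stable_average X (p : set (pform M X)) :
  small K [set: X] -> generically_stable K A p ->
  exists beta : nat -> X -> M,
    [/\ iset A beta, nonforking A (average beta) & realizes (beta 0) p].
Proof.
move=> sX [d [I [a [[_ /infinite_nat_inj[i iinj]] [_ ap ai] aset]]]].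
pose beta k := a (i k); exists beta.
have ib : iset A beta.
  move=> f fi; suff : eqtp (A `|` range (of_void M)) (flat beta) (flat (beta \o f)).
    by apply: eqtp_mono; exact: subsetUl.
  apply: rows_eqtp => n P dP.
  have h1 : injective (fun j : 'I_n.+1 => i j) by move=> j k /iinj/ord_inj.
  have h2 : injective (fun j : 'I_n.+1 => i (f j)) by move=> j k /iinj/fi/ord_inj.
  have /tpP e := aset _ _ _ h1 h2.
  have {}e : eqtp (A `|` range (of_void M)) (rows beta (n := n)) (rows (beta \o f) (n := n)).
    by apply: eqtp_mono e => m [//|[[]]].
  by move/eqtp_add : e; apply.
split=> //; last exact: ap.
have sB : small K (A `|` range (flat beta)).
  by apply: small_setU => //; exact: (small_flat hM).
have key P : definable (A `|` range (flat beta)) P -> average beta P -> ~ forking_set A P.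
  move=> /def_split[Q dQ eQ] [N hN] fP.
  pose sw (z : X + nat * X) : nat * X + X := match z with inl y => inr y | inr y => inl y end.
  have [n [Q' dQ' eQ']] := def_rows (def_comp sw dQ).
  have E u v : copair (flat u) v \o sw = copair v (flat u) by apply/funext => -[].
  have PQ v : P v <-> Q' (copair (rows beta (n := n)) v) by rewrite eQ -eQ' E.
  pose k := maxn N n.+1.
  have Pk : Q' (copair (rows beta (n := n)) (beta k)).
    by apply/PQ/hN; exact: leq_maxl.
  have nk : n < k by exact: leq_maxr.
  (* Two exchanges move the tested term to the position that is last in [I]. All parameters then
     precede it, so freeness in the Morley sequence applies. *)
  have [m mn hm] := exists_last i n.+1.
  pose r (z : 'I_n.+1 * X + X) : nat * X :=
    match z with inl y => (nat_of_ord y.1, y.2) | inr x => (n.+1, x) end.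
  have Er (u : nat -> X -> M) : flat u \o r = copair (rows u (n := n)) (u n.+1).
    by apply/funext => -[].
  have Q1 : Q' (flat (beta \o exchange n.+1 k) \o r).
    rewrite Er /= {2}/exchange eqxx.
    suff -> : rows (beta \o exchange n.+1 k) (n := n) = rows beta (n := n) by [].
    apply/funext => -[[j lj] x]; rewrite /rows /= /exchange.
    by rewrite ifF; [rewrite ifF //; lia|lia].
  have Q2 : Q' (flat (beta \o exchange m n.+1) \o r).
    have := def_comp r dQ' => dr.
    apply: (ib _ (@exchange_inj m n.+1) _ dr).
    exact: (eqtp_sym (ib _ (@exchange_inj n.+1 k)) dr Q1).
  have sm : exchange m n.+1 n.+1 = m by rewrite /exchange eqxx; case: (n.+1 =P m).
  rewrite Er /= sm in Q2.
  pose sw' (z : 'I_n.+1 * X + X) : X + 'I_n.+1 * X :=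
    match z with inl y => inr y | inr y => inl y end.
  have E' u v : copair v u \o sw' = copair u v by apply/funext => -[].
  have sR : small K [set: 'I_n.+1 * X] by apply: small_prod => //; exact: small_ord.
  have e : eqtp A (rows beta (n := n)) (rows (beta \o exchange m n.+1) (n := n)).
    exact: (eqtp_comp (f := fun z : 'I_n.+1 * X => (nat_of_ord z.1, z.2))
      (ib _ (@exchange_inj m n.+1))).
  have f1 : forking_set A (fun v => Q' (copair v (rows beta (n := n)) \o sw')).
    have [b [delta [h1 h2]]] := fP; exists b, delta; split=> // v.
    by rewrite E' => /PQ; exact: h2.
  have f2 := forking_set_eqtp hM sR sA (@subset_refl _ A) (def_comp sw' dQ') e f1.
  have /indepP/freeP := ai (i m).
  move=> /(_ _ _ _ f2); apply; last by rewrite E'.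
  apply: (def_fiber _ _ (def_comp sw' dQ')); first exact: subsetUl.
  move=> [j x]; right; exists (i (exchange m n.+1 j)), x; split=> //.
  have jm : exchange m n.+1 j != m.
    apply/eqP => jm; have := ltn_ord j.
    have /exchange_inj -> : exchange m n.+1 j = exchange m n.+1 n.+1 by rewrite jm sm.
    by rewrite ltnn.
  rewrite Order.POrderTheory.lt_neqAle; apply/andP; split.
    by apply: contra jm => /eqP/iinj ->.
  apply: hm; rewrite /exchange; have := ltn_ord j.
  by case: (nat_of_ord j =P m); case: (nat_of_ord j =P n.+1); lia.
pose G : set_system (X -> M) := [set S | exists P,
  [/\ definable (A `|` range (flat beta)) P, average beta P & P `<=` S]].
have [||F [gF nF GF]] := @nonforking_extension _ _ X A G.
- split; first by exists setT; split=> //; [exact: (@def_const _ _ _ X True)|exists 0].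
    move=> S S' [P [dP Pa PS]] [P' [dP' P'a PS']]; exists (P `&` P'); split.
    + exact: def_and.
    + by have pA := average_proper beta; exact: filterI.
    + by move=> v [Pv P'v]; split; [exact: PS|exact: PS'].
  by move=> S S' SS' [P [dP Pa PS]]; exists P; split=> // v /PS; exact: SS'.
- move=> S [P [dP Pa PS]] [b [delta [hd himp]]]; apply: (key P dP Pa).
  by exists b, delta; split=> // v /PS; exact: himp.
have FA := nonforking_average hM hNIP sA sX ib gF nF
  (fun P dP avP => GF P (ex_intro _ P (And3 dP avP (@subset_refl _ P)))).
move=> th hth avth.
have dth : definable setT (fun v => psat v th) by exact: def_psat.
case: (global_decide gF dth) => [/(nF _ hth) //|/(FA _ (def_not dth))].
have pA := average_proper beta.
by move=> /(filterI avth)/filter_ex[v []].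
Qed.

End GenericStability.

Theorem theorem5p2
  (L : language) (T : set (sentence L)) (hT : complete_theory T)
  (hNIP : dependent T)
  (M : structure L) (hM : model T M) (K : Type) (hK : monster M K)
  (A : set M) (hA : small K A) (hbase : extension_base K A)
  (X Y : Type) (hX : small K [set: X]%classic) (hY : small K [set: Y]%classic)
  (p : set (pform M X)) (hp : complete_type A p)
  (hgs : generically_stable K A p)
  (q : set (pform M Y)) (hq : complete_type A q)
  (hcd : co_dominated K A q p)
  (d : Order.disp_t) (I : orderType d) (hI : small_infinite K I)
  (a : I -> Y -> M) (ha : morley A q a) :
  strict_morley K A a.
Proof.
have nip := hNIP M hM.
have [beta [ib nb bp]] := generically_stable_average hK nip hA hX hgs.
case: ha => ia aq ani; split=> // i.
(* Any global nonforking extension serves; strictness will come from symmetry and not from the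
   choice of [F]. *)
have /indepP[F [gF nF hF]] := ani i; have pF := gF.1.
exists [set th | F (fun v => psat v th)]; split.
- split=> [//|n th h|th _].
    have : F (fun v => forall j, psat v (th j)) by apply: filter_forall => j; exact: h.
    exact: filter_ex.
  exact: (global_decide gF (def_psat (B := setT) (th := th) _)).
- by move=> th [ov pa]; exact: (hF _ (def_psat ov) pa).
- move=> [b [delta [hd [n [th [hth himp]]]]]].
  have Fth : F (fun v => forall j, psat v (th j)) by apply: filter_forall => j; exact: hth.
  by apply: (nonforking_set gF nF Fth); exists b, delta.
- move=> D c sD AD cD [delta hdelta himp].
  have rc : realizes_over F D c.
    move=> P /def_pform[th ov e] FP; apply/e; apply: cD; split=> //.
    by rewrite /=; apply: filterS FP => v /e.
  have AsubD : A `<=` D by move=> m Am; apply: AD; left.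
  have DE : A `|` D = D by apply/setUidPr.
  have rE : range (@Defs.enum_tuple L M D) = D.
    by apply/seteqP; split=> [_ [[m Dm] _ <-]|m Dm] //; exists (exist _ m Dm).
  have fc : free c A (range (@Defs.enum_tuple L M D)).
    (* Since [c] realizes a nonforking type over [D], it is free from [D]; it also realizes [q], so
       symmetry makes [D] free from [c]. Dividing is then excluded as forking with a single
       disjunct. *)
    by rewrite rE; apply: (realizes_over_free gF nF); rewrite DE.
  have cq : realizes c q.
    apply/(realizes_eqtp _ hq (aq i)) => P dP Pa; apply: rc; first exact: def_mono dP.
    by apply: hF => //; apply: def_mono dP; exact: subsetUl.
  have sDt : small K [set: {m | D m}] by exact: small_sig.
  have := co_dominated_free hK nip hA hbase hX hY sDt hp hq hcd ib nb bp cq fc.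
  by move=> /indepP; apply; exists 1, (fun=> delta).
Qed.
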